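(* Let $k\geq 2$ and let $(\Sigma_k,\sigma)$ be the full one-sided shift on $k$ symbols. Then for each $i\in\{1,\dots,6\}$, the set $\{x\in Rec(\Sigma_k)\setminus BR(\Sigma_k): x \text{ satisfies Case } (i')\}$ is dense in $\Sigma_k$ and contains an uncountable DC1-scrambled subset.
   Context: $\Sigma_k=\{0,1,\dots,k-1\}^{\mathbb{N}}$ with metric $d(x,y)=\sum_{n\ge1}\delta(x_n,y_n)/2^n$ ($\delta(a,b)=0$ if $a=b$, $1$ otherwise) and shift $\sigma(x_1x_2\dots)=(x_2x_3\dots)$. $N(x,U)=\{n\ge1:\sigma^n(x)\in U\}$, $B_\varepsilon(x)$ the open $\varepsilon$-ball. For $S\subseteq\mathbb{N}$: $\overline d(S)=\limsup_n |S\cap\{0,\dots,n-1\}|/n$, $\underline d(S)=\liminf_n |S\cap\{0,\dots,n-1\}|/n$, $B^*(S)=\limsup_{|I|\to\infty}|S\cap I|/|I|$, $B_*(S)=\liminf_{|I|\to\infty}|S\cap I|/|I|$ ($I$ ranging over finite intervals of consecutive integers). $x\in Rec$ if $N(x,B_\varepsilon(x))\ne\emptyset$ for all $\varepsilon>0$; $x\in BR$ if $B^*(N(x,B_\varepsilon(x)))>0$ for all $\varepsilon>0$. For $\xi\in\{\overline d,\underline d,B^*,B_*\}$, $\omega_\xi(x)$ is the set of $y$ such that $\xi(N(x,B_\varepsilon(y)))>0$ for every $\varepsilon>0$; $\omega_\sigma(x)$ is the usual $\omega$-limit set. Cases: (1') $\omega_{B_*}(x)\subsetneq\omega_{\underline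 d}(x)=\omega_{\overline d}(x)=\omega_{B^*}(x)\subsetneq\omega_\sigma(x)$; (2') $\omega_{B_*}(x)\subsetneq\omega_{\underline d}(x)=\omega_{\overline d}(x)\subsetneq\omega_{B^*}(x)\subsetneq\omega_\sigma(x)$; (3') $\omega_{B_*}(x)=\omega_{\underline d}(x)\subsetneq\omega_{\overline d}(x)=\omega_{B^*}(x)\subsetneq\omega_\sigma(x)$; (4') $\omega_{B_*}(x)\subsetneq\omega_{\underline d}(x)\subsetneq\omega_{\overline d}(x)=\omega_{B^*}(x)\subsetneq\omega_\sigma(x)$; (5') $\omega_{B_*}(x)=\omega_{\underline d}(x)\subsetneq\omega_{\overline d}(x)\subsetneq\omega_{B^*}(x)\subsetneq\omega_\sigma(x)$; (6') $\omega_{B_*}(x)\subsetneq\omega_{\underline d}(x)\subsetneq\omega_{\overline d}(x)\subsetneq\omega_{B^*}(x)\subsetneq\omega_\sigma(x)$. DC1: with $\Phi^{(n)}_{xy}(t)=\frac1n|\{0\le i<n: d(\sigma^ix,\sigma^iy)<t\}|$, a pair $(x,y)$ is DC1 if $\liminf_n\Phi^{(n)}_{xy}(s)=0$ for some $s>0$ and $\limsup_n\Phi^{(n)}_{xy}(t)=1$ for all $t>0$; a set of at least two points is DC1-scrambled if every pair of distinct points in it is DC1. *)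

(* Defs.v *)
From Stdlib Require Import Reals Lra Lia ClassicalEpsilon.
From Coquelicot Require Import Coquelicot.
Open Scope R_scope.

(* Points of Sigma_k: sequences x : nat -> nat with all symbols < k.
   Indexing is from 0: x 0 is the paper's x_1. *)
Definition InSigma (k : nat) (x : nat -> nat) : Prop := forall n, (x n < k)%nat.

Definition shift (x : nat -> nat) : nat -> nat := fun m => x (S m).
Definition shiftn (n : nat) (x : nat -> nat) : nat -> nat := fun m => x (m + n)%nat.

Definition delta (a b : nat) : R := if Nat.eq_dec a b then 0 else 1.

Definition dist (x y : nat -> nat) : R :=
  Series (fun n => delta (x n) (y n) / 2 ^ (S n)).

Definition ball (k : nat) (x : nat -> nat) (eps : R) : (nat -> nat) -> Prop :=
  fun y => InSigma k y /\ dist x y < eps.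

Definition Nset (x : nat -> nat) (U : (nat -> nat) -> Prop) : nat -> Prop :=
  fun n => (1 <= n)%nat /\ U (shiftn n x).

Fixpoint cnt (S : nat -> Prop) (m n : nat) : nat :=
  match n with
  | O => O
  | Datatypes.S n' => (cnt S m n' + if excluded_middle_informative (S (m + n')%nat) then 1 else 0)%nat
  end.

Definition ratio (S : nat -> Prop) (m n : nat) : R := INR (cnt S m n) / INR n.

Definition upper_density (S : nat -> Prop) : Rbar := LimSup_seq (fun n => ratio S 0 n).
Definition lower_density (S : nat -> Prop) : Rbar := LimInf_seq (fun n => ratio S 0 n).
(* upper / lower Banach density: limsup/liminf over intervals [m, m+n) of N
   as the length n -> oo, i.e. limsup_n sup_m and liminf_n inf_m *)
Definition upper_Banach (S : nat -> Prop) : Rbar :=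
  LimSup_seq (fun n => real (Sup_seq (fun m => Finite (ratio S m n)))).
Definition lower_Banach (S : nat -> Prop) : Rbar :=
  LimInf_seq (fun n => real (Inf_seq (fun m => Finite (ratio S m n)))).

Definition Rec (k : nat) (x : nat -> nat) : Prop :=
  forall eps, 0 < eps -> exists n, Nset x (ball k x eps) n.

Definition BR (k : nat) (x : nat -> nat) : Prop :=
  forall eps, 0 < eps -> Rbar_lt (Finite 0) (upper_Banach (Nset x (ball k x eps))).

Definition omega_xi (xi : (nat -> Prop) -> Rbar) (k : nat) (x : nat -> nat) :
  (nat -> nat) -> Prop :=
  fun y => InSigma k y /\
    forall eps, 0 < eps -> Rbar_lt (Finite 0) (xi (Nset x (ball k y eps))).

Definition omega_sigma (k : nat) (x : nat -> nat) : (nat -> nat) -> Prop :=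
  fun y => InSigma k y /\
    forall eps, 0 < eps -> forall N : nat, exists n, (N <= n)%nat /\ dist (shiftn n x) y < eps.

Definition set_eq (A B : (nat -> nat) -> Prop) : Prop := forall y, A y <-> B y.
Definition set_sub (A B : (nat -> nat) -> Prop) : Prop := forall y, A y -> B y.
Definition set_ssub (A B : (nat -> nat) -> Prop) : Prop :=
  set_sub A B /\ ~ set_eq A B.

Definition Case (k i : nat) (x : nat -> nat) : Prop :=
  let wBl := omega_xi lower_Banach k x in
  let wdl := omega_xi lower_density k x in
  let wdu := omega_xi upper_density k x in
  let wBu := omega_xi upper_Banach k x in
  let ws := omega_sigma k x in
  match i with
  | 1%nat => set_ssub wBl wdl /\ set_eq wdl wdu /\ set_eq wdu wBu /\ set_ssub wBu ws
  | 2%nat => set_ssub wBl wdl /\ set_eq wdl wdu /\ set_ssub wdu wBu /\ set_ssub wBu ws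
  | 3%nat => set_eq wBl wdl /\ set_ssub wdl wdu /\ set_eq wdu wBu /\ set_ssub wBu ws
  | 4%nat => set_ssub wBl wdl /\ set_ssub wdl wdu /\ set_eq wdu wBu /\ set_ssub wBu ws
  | 5%nat => set_eq wBl wdl /\ set_ssub wdl wdu /\ set_ssub wdu wBu /\ set_ssub wBu ws
  | 6%nat => set_ssub wBl wdl /\ set_ssub wdl wdu /\ set_ssub wdu wBu /\ set_ssub wBu ws
  | _ => False
  end.

Definition Phi (x y : nat -> nat) (t : R) (n : nat) : R :=
  INR (cnt (fun i => dist (shiftn i x) (shiftn i y) < t) 0 n) / INR n.

Definition DC1_pair (x y : nat -> nat) : Prop :=
  (exists s, 0 < s /\ LimInf_seq (Phi x y s) = Finite 0) /\
  (forall t, 0 < t -> LimSup_seq (Phi x y t) = Finite 1).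

Definition DC1_scrambled (S : (nat -> nat) -> Prop) : Prop :=
  (exists x y, S x /\ S y /\ x <> y) /\
  forall x y, S x -> S y -> x <> y -> DC1_pair x y.

Definition Uncountable (S : (nat -> nat) -> Prop) : Prop :=
  ~ exists f : (nat -> nat) -> nat,
      forall x y, S x -> S y -> f x = f y -> x = y.

Definition Dense (k : nat) (A : (nat -> nat) -> Prop) : Prop :=
  forall x, InSigma k x -> forall eps, 0 < eps -> exists y, A y /\ dist x y < eps.

(* Main.v *)
(** Toeplitz-like construction.  A point x is built from nested prefixes W_0, W_1, ...
    of lengths L_0, L_1, ..., where W_(n+1) is the concatenation of 2n+7 blocks of
    length L_n: W_n, then 2n+4 constant blocks 0 or 1, then one block which is
    either alternating (01)^* or zero, then W_n again.  The final copy makes x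
    recurrent.  Every aligned block of length L_n is a copy of W_n, constant or
    alternating, so the places where x_i <> x_(i+2) have Banach density zero; if W_0
    contains such a place, x is not in BR and omega_(B^* ) is properly contained in
    omega_sigma.

    The omega_xi sets are then read off the constant blocks.  In all six cases
    omega_(B_* ) is empty and the one for upper density is {0^oo, 1^oo}.  The one for
    lower density is {0^oo, 1^oo} if the two symbols alternate from block to block in
    every stage, empty if each stage uses one symbol, and {0^oo} if alternating
    stages alternate with zero stages.  Independently, omega_(B^* ) is enlarged
    by (01)^oo exactly when the special blocks are alternating.

    Even stages do not depend on the parameter a in {0,1}^N; at infinitely many odd
    stages two different parameters give blockwise opposite symbols.  As stage n
    makes up all but a fraction O(1/n) of its prefix, different parameters give DC1
    pairs. *)

From Stdlib Require Import Reals Lra Lia Arith ClassicalEpsilon FunctionalExtensionality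
  Bool Cantor.
From Coquelicot Require Import Coquelicot.
Require Import Defs.

(** * Densities and the metric *)

(** The sets [omega_xi] depend only on whether a density is positive, so values in [Rbar] are traded
    here for quantifier statements about a constant [c]. *)
Lemma LimSup_seq_pos (u : nat -> R) :
  Rbar_lt 0 (LimSup_seq u) <->
  exists c, 0 < c /\ forall N, exists n, (N <= n)%nat /\ c <= u n.
Proof.
  unfold LimSup_seq; destruct (ex_LimSup_seq u) as [l Hl]; simpl.
  destruct l as [l | |]; simpl in *; split.
  - intros Hpos.
    assert (H : 0 < l / 2) by lra.
    exists (l / 2); split; [lra | intros N].
    destruct (Hl (mkposreal _ H)) as [Hi _]; destruct (Hi N) as [n [Hn Hu]].
    exists n; split; [exact Hn | simpl in Hu; lra].
  - intros [c [Hc Hi]].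
    destruct (Rlt_dec 0 l) as [Hlt | Hge]; [exact Hlt | exfalso].
    assert (H : 0 < c / 2) by lra.
    destruct (Hl (mkposreal _ H)) as [_ [N HN]]; destruct (Hi N) as [n [Hn Hu]].
    specialize (HN n Hn); simpl in HN; lra.
  - intros _; exists 1; split; [lra | intros N].
    destruct (Hl 1 N) as [n [Hn Hu]]; exists n; split; [exact Hn | lra].
  - easy.
  - easy.
  - intros [c [Hc Hi]].
    destruct (Hl c) as [N HN]; destruct (Hi N) as [n [Hn Hu]].
    specialize (HN n Hn); lra.
Qed.

Lemma LimInf_seq_pos (u : nat -> R) :
  Rbar_lt 0 (LimInf_seq u) <->
  exists c, 0 < c /\ exists N, forall n, (N <= n)%nat -> c <= u n.
Proof.
  unfold LimInf_seq; destruct (ex_LimInf_seq u) as [l Hl]; simpl.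
  destruct l as [l | |]; simpl in *; split.
  - intros Hpos.
    assert (H : 0 < l / 2) by lra.
    exists (l / 2); split; [lra |].
    destruct (Hl (mkposreal _ H)) as [_ [N HN]]; exists N; intros n Hn.
    specialize (HN n Hn); simpl in HN; lra.
  - intros [c [Hc [N HN]]].
    destruct (Rlt_dec 0 l) as [Hlt | Hge]; [exact Hlt | exfalso].
    assert (H : 0 < c / 2) by lra.
    destruct (Hl (mkposreal _ H)) as [Hi _]; destruct (Hi N) as [n [Hn Hu]].
    specialize (HN n Hn); simpl in Hu; lra.
  - intros _; exists 1; split; [lra |].
    destruct (Hl 1) as [N HN]; exists N; intros n Hn; specialize (HN n Hn); lra.
  - easy.
  - easy.
  - intros [c [Hc [N HN]]].
    destruct (Hl c N) as [n [Hn Hu]]; specialize (HN n Hn); lra.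
Qed.

(** * Counting in windows and ratios *)

Lemma cnt_le (S : nat -> Prop) (m n : nat) : (cnt S m n <= n)%nat.
Proof.
  induction n as [|n IH]; simpl; [lia |].
  destruct (excluded_middle_informative (S (m + n)%nat)); lia.
Qed.

Lemma cnt_add (S : nat -> Prop) (m a b : nat) :
  cnt S m (a + b) = (cnt S m a + cnt S (m + a) b)%nat.
Proof.
  induction b as [|b IH]; [rewrite Nat.add_0_r; simpl; lia |].
  rewrite Nat.add_succ_r; simpl; rewrite IH, Nat.add_assoc; lia.
Qed.

Lemma cnt_shift_le (S T : nat -> Prop) (m m' n : nat) :
  (forall i, (i < n)%nat -> S (m + i)%nat -> T (m' + i)%nat) ->
  (cnt S m n <= cnt T m' n)%nat.
Proof.
  induction n as [|n IH]; intros H; simpl; [lia |].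
  assert (IH' := IH (fun i Hi => H i (Nat.lt_lt_succ_r _ _ Hi))).
  destruct (excluded_middle_informative (S (m + n)%nat)) as [HS | HS];
    destruct (excluded_middle_informative (T (m' + n)%nat)) as [HT | HT]; try lia.
  exfalso; apply HT, H; [lia | exact HS].
Qed.

Lemma cnt_full (S : nat -> Prop) (m n : nat) :
  (forall i, (i < n)%nat -> S (m + i)%nat) -> cnt S m n = n.
Proof.
  induction n as [|n IH]; intros H; simpl; [reflexivity |].
  rewrite IH by (intros i Hi; apply H; lia).
  destruct (excluded_middle_informative (S (m + n)%nat)) as [_ | HS]; [lia |].
  exfalso; apply HS, H; lia.
Qed.

Lemma cnt_none (S : nat -> Prop) (m n : nat) :
  (forall i, (i < n)%nat -> ~ S (m + i)%nat) -> cnt S m n = 0%nat.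
Proof.
  induction n as [|n IH]; intros H; simpl; [reflexivity |].
  rewrite IH by (intros i Hi; apply H; lia).
  destruct (excluded_middle_informative (S (m + n)%nat)) as [HS | _]; [|lia].
  exfalso; apply (H n); [lia | exact HS].
Qed.

Lemma cnt_le_prefix (S : nat -> Prop) (m a b : nat) :
  (a <= b)%nat -> (cnt S m a <= cnt S m b)%nat.
Proof.
  intros H; replace b with (a + (b - a))%nat by lia; rewrite cnt_add; lia.
Qed.

Lemma cnt_blocks_le (S : nat -> Prop) (L B m q : nat) :
  (forall j, (j < q)%nat -> (cnt S (m + j * L) L <= B)%nat) ->
  (cnt S m (q * L) <= q * B)%nat.
Proof.
  induction q as [|q IH]; intros H; simpl; [lia |].
  rewrite Nat.add_comm, cnt_add.
  assert (H1 := IH (fun j Hj => H j (Nat.lt_lt_succ_r _ _ Hj))).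
  assert (H2 := H q (Nat.lt_succ_diag_r q)); lia.
Qed.

Lemma cnt_blocks_ge (S : nat -> Prop) (L B m q : nat) :
  (forall j, (j < q)%nat -> (B <= cnt S (m + j * L) L)%nat) ->
  (q * B <= cnt S m (q * L))%nat.
Proof.
  induction q as [|q IH]; intros H; simpl; [lia |].
  rewrite (Nat.add_comm L), cnt_add.
  assert (H1 := IH (fun j Hj => H j (Nat.lt_lt_succ_r _ _ Hj))).
  assert (H2 := H q (Nat.lt_succ_diag_r q)); lia.
Qed.

Lemma ratio_bounds (S : nat -> Prop) (m n : nat) : 0 <= ratio S m n <= 1.
Proof.
  unfold ratio; destruct n as [|n]; [simpl; unfold Rdiv; rewrite Rmult_0_l; lra |].
  assert (Hn : 0 < INR (Datatypes.S n)) by (apply lt_0_INR; lia).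
  assert (Hc := le_INR _ _ (cnt_le S m (Datatypes.S n))).
  assert (H0 := pos_INR (cnt S m (Datatypes.S n))).
  split.
  - apply Rmult_le_pos; [exact H0 | left; apply Rinv_0_lt_compat; exact Hn].
  - apply Rle_div_l; lra.
Qed.

Lemma ratio_ge_inv (S : nat -> Prop) (K m n : nat) :
  (1 <= n)%nat -> (n <= K * cnt S m n)%nat -> / INR (1 + K) <= ratio S m n.
Proof.
  intros Hn H; unfold ratio.
  assert (Hn' : 0 < INR n) by (apply lt_0_INR; lia).
  (* Using [1 + K] keeps the denominator positive without a case distinction on [K]. *)
  assert (HK : 0 < INR (1 + K)) by (apply lt_0_INR; lia).
  assert (H' : INR n <= INR (1 + K) * INR (cnt S m n))
    by (rewrite <- mult_INR; apply le_INR; nia).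
  apply Rmult_le_reg_l with (1 := HK).
  rewrite Rinv_r by lra.
  unfold Rdiv; rewrite <- Rmult_assoc.
  apply Rle_div_r; lra.
Qed.

Lemma cnt_ge_of_ratio (c : R) (hc : 0 < c) :
  exists K, forall (S : nat -> Prop) (m n : nat),
    c <= ratio S m n -> (n <= K * cnt S m n)%nat.
Proof.
  destruct (archimed_cor1 c hc) as [K [HK HK0]]; exists K; intros S m n H.
  destruct n as [|n]; [lia |].
  assert (Hn' : 0 < INR (Datatypes.S n)) by (apply lt_0_INR; lia).
  assert (HK' : 0 < INR K) by (apply lt_0_INR; lia).
  apply INR_le; rewrite mult_INR; unfold ratio in H.
  apply Rle_div_r in H; [|lra].
  apply Rle_trans with (INR K * (c * INR (Datatypes.S n)));
    [|apply Rmult_le_compat_l; lra].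
  rewrite <- Rmult_assoc.
  assert (1 <= INR K * c); [|nra].
  apply Rmult_lt_compat_l with (r := INR K) in HK; [|exact HK'].
  rewrite Rinv_r in HK; lra.
Qed.

(** [real] sends both infinities to 0, so the supremum must first be seen to be finite; this follows
    from [ratio_bounds]. *)
Lemma le_Sup_ratio (S : nat -> Prop) (m n : nat) :
  ratio S m n <= real (Sup_seq (fun m => Finite (ratio S m n))).
Proof.
  set (s := Sup_seq _).
  assert (H1 : Rbar_le (ratio S m n) s)
    by (apply Sup_seq_minor_le with m; simpl; lra).
  assert (H2 : Rbar_le s 1).
  { apply Rbar_not_lt_le; intros H; unfold s in H; apply Sup_seq_minor_lt in H.
    destruct H as [p Hp]; simpl in Hp; assert (B := ratio_bounds S p n); lra. }
  destruct s as [s | |]; simpl in *; easy || lra.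
Qed.

(** Giving up a factor 2 makes the inequality with the supremum strict, so that some window
    witnesses it. *)
Lemma Sup_ratio_approx (S : nat -> Prop) (n : nat) (c : R) :
  0 < c <= real (Sup_seq (fun m => Finite (ratio S m n))) ->
  exists m, c / 2 <= ratio S m n.
Proof.
  intros [H0 H].
  assert (Hlt : Rbar_lt (c / 2) (Sup_seq (fun m => Finite (ratio S m n)))).
  { destruct (Sup_seq _) as [s | |]; simpl in *; lra || easy. }
  apply Sup_seq_minor_lt in Hlt; destruct Hlt as [m Hm]; exists m; simpl in Hm; lra.
Qed.

Lemma Inf_ratio_ge (S : nat -> Prop) (n : nat) (c : R) :
  0 < c ->
  (c <= real (Inf_seq (fun m => Finite (ratio S m n))) <->
   forall m, c <= ratio S m n).
Proof.
  intros Hc.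
  assert (Hi := Inf_seq_correct (fun m => Finite (ratio S m n))).
  destruct (Inf_seq _) as [s | |]; simpl in *.
  - split.
    + intros H m; apply Rnot_lt_le; intros Hlt.
      assert (He : 0 < c - ratio S m n) by lra.
      destruct (Hi (mkposreal _ He)) as [H1 _]; specialize (H1 m); simpl in H1; lra.
    + intros H; apply Rnot_lt_le; intros Hlt.
      assert (He : 0 < c - s) by lra.
      destruct (Hi (mkposreal _ He)) as [_ [m Hm]]; specialize (H m); simpl in Hm; lra.
  - exfalso; specialize (Hi 2 0%nat); assert (B := ratio_bounds S 0 n); lra.
  - exfalso; destruct (Hi 0) as [m Hm]; assert (B := ratio_bounds S m n); lra.
Qed.

(** * Positivity of the four densities as inequalities between natural numbers *)

Lemma inv_INR_pos (K : nat) : 0 < / INR (1 + K).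
Proof. apply Rinv_0_lt_compat, lt_0_INR; lia. Qed.

(** [n <= K * cnt S 0 n] says that the ratio is at least [1 / K]. With this form for all four
    densities, the combinatorial part stays within [nat]. *)
Lemma upper_density_pos (S : nat -> Prop) :
  Rbar_lt 0 (upper_density S) <->
  exists K, forall N, exists n, (N <= n)%nat /\ (1 <= n <= K * cnt S 0 n)%nat.
Proof.
  unfold upper_density; rewrite LimSup_seq_pos; split.
  - intros [c [Hc H]]; destruct (cnt_ge_of_ratio c Hc) as [K HK]; exists K; intros N.
    destruct (H (1 + N)%nat) as [n [Hn Hr]]; apply HK in Hr; exists n; lia.
  - intros [K H]; exists (/ INR (1 + K)); split; [apply inv_INR_pos | intros N].
    destruct (H N) as [n [Hn Hr]]; exists n; split; [exact Hn |].
    apply ratio_ge_inv; lia.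
Qed.

Lemma lower_density_pos (S : nat -> Prop) :
  Rbar_lt 0 (lower_density S) <->
  exists K N, forall n, (N <= n)%nat -> (n <= K * cnt S 0 n)%nat.
Proof.
  unfold lower_density; rewrite LimInf_seq_pos; split.
  - intros [c [Hc [N H]]]; destruct (cnt_ge_of_ratio c Hc) as [K HK].
    exists K, N; intros n Hn; apply HK, H, Hn.
  - intros [K [N H]]; exists (/ INR (1 + K)); split; [apply inv_INR_pos |].
    exists (1 + N)%nat; intros n Hn; apply ratio_ge_inv; [lia | apply H; lia].
Qed.

Lemma upper_Banach_pos (S : nat -> Prop) :
  Rbar_lt 0 (upper_Banach S) <->
  exists K, forall N, exists n m, (N <= n)%nat /\ (1 <= n <= K * cnt S m n)%nat.
Proof.
  unfold upper_Banach; rewrite LimSup_seq_pos; split.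
  - intros [c [Hc H]].
    assert (Hc2 : 0 < c / 2) by lra.
    destruct (cnt_ge_of_ratio (c / 2) Hc2) as [K HK]; exists K; intros N.
    destruct (H (1 + N)%nat) as [n [Hn Hr]].
    destruct (Sup_ratio_approx S n c (conj Hc Hr)) as [m Hm].
    apply HK in Hm; exists n, m; lia.
  - intros [K H]; exists (/ INR (1 + K)); split; [apply inv_INR_pos | intros N].
    destruct (H N) as [n [m [Hn Hr]]]; exists n; split; [exact Hn |].
    eapply Rle_trans; [|apply (le_Sup_ratio S m n)].
    apply ratio_ge_inv; lia.
Qed.

Lemma lower_Banach_pos (S : nat -> Prop) :
  Rbar_lt 0 (lower_Banach S) <->
  exists K N, forall n m, (N <= n)%nat -> (n <= K * cnt S m n)%nat.
Proof.
  unfold lower_Banach; rewrite LimInf_seq_pos; split.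
  - intros [c [Hc [N H]]]; destruct (cnt_ge_of_ratio c Hc) as [K HK].
    exists K, N; intros n m Hn; apply HK.
    apply (proj1 (Inf_ratio_ge S n c Hc)), H, Hn.
  - intros [K [N H]]; exists (/ INR (1 + K)); split; [apply inv_INR_pos |].
    exists (1 + N)%nat; intros n Hn; apply Inf_ratio_ge; [apply inv_INR_pos |].
    intros m; apply ratio_ge_inv; [lia | apply H; lia].
Qed.

Lemma lower_Banach_le_lower_density (S : nat -> Prop) :
  Rbar_lt 0 (lower_Banach S) -> Rbar_lt 0 (lower_density S).
Proof.
  rewrite lower_Banach_pos, lower_density_pos; intros [K [N H]].
  exists K, N; intros n; apply H.
Qed.

Lemma lower_density_le_upper_density (S : nat -> Prop) :
  Rbar_lt 0 (lower_density S) -> Rbar_lt 0 (upper_density S).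
Proof.
  rewrite lower_density_pos, upper_density_pos; intros [K [N H]].
  exists K; intros M; exists (1 + N + M)%nat; split; [lia |].
  split; [lia | apply H; lia].
Qed.

Lemma upper_density_le_upper_Banach (S : nat -> Prop) :
  Rbar_lt 0 (upper_density S) -> Rbar_lt 0 (upper_Banach S).
Proof.
  rewrite upper_density_pos, upper_Banach_pos; intros [K H].
  exists K; intros N; destruct (H N) as [n Hn]; exists n, 0%nat; exact Hn.
Qed.

Lemma upper_Banach_pos_infinite (S : nat -> Prop) (N : nat) :
  Rbar_lt 0 (upper_Banach S) -> exists n, (N <= n)%nat /\ S n.
Proof.
  rewrite upper_Banach_pos; intros [K H].
  destruct (excluded_middle_informative (exists n, (N <= n)%nat /\ S n))
    as [E | E]; [exact E | exfalso].
  (* A window longer than [K * N] would need more than [N] points of [S], but only the [N] positions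
     below [N] are available. *)
  destruct (H (K * N + 1)%nat) as [n [m [Hn Hc]]].
  assert (B : (cnt S m n <= N)%nat).
  { replace n with (Nat.min n N + (n - N))%nat by lia; rewrite cnt_add.
    rewrite (cnt_none S (m + Nat.min n N)).
    - assert (C := cnt_le S m (Nat.min n N)); lia.
    - intros i Hi HS; apply E; exists (m + Nat.min n N + i)%nat; split; [lia | exact HS]. }
  nia.
Qed.

(** * The metric and agreement of initial words *)

Lemma dist_summand_bounds (x y : nat -> nat) (n : nat) :
  0 <= delta (x n) (y n) / 2 ^ Datatypes.S n <= / 2 * (/ 2) ^ n.
Proof.
  assert (H : 0 < / 2 ^ Datatypes.S n) by (apply Rinv_0_lt_compat, pow_lt; lra).
  change (/ 2 * (/ 2) ^ n) with ((/ 2) ^ Datatypes.S n); rewrite pow_inv.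
  unfold delta, Rdiv; destruct (Nat.eq_dec (x n) (y n)); lra.
Qed.

Lemma ex_series_half : ex_series (fun n => / 2 * (/ 2) ^ n).
Proof.
  apply @ex_series_scal_l with (c := / 2) (a := fun n => (/ 2) ^ n).
  apply ex_series_geom; rewrite Rabs_pos_eq; lra.
Qed.

Lemma ex_series_dist (x y : nat -> nat) :
  ex_series (fun n => delta (x n) (y n) / 2 ^ Datatypes.S n).
Proof.
  apply @ex_series_le with (b := fun n => / 2 * (/ 2) ^ n); [|apply ex_series_half].
  intros n; assert (B := dist_summand_bounds x y n).
  change norm with Rabs; rewrite Rabs_pos_eq; lra.
Qed.

Lemma dist_bounds (x y : nat -> nat) : 0 <= dist x y <= 1.
Proof.
  unfold dist; split.
  - apply Rle_trans with (Series (fun n => 0)).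
    + right; rewrite (Series_ext (fun _ => 0) (fun _ => 0 * 0)) by (intros; ring).
      rewrite Series_scal_l; ring.
    + apply Series_le; [|apply ex_series_dist].
      intros n; assert (B := dist_summand_bounds x y n); lra.
  - apply Rle_trans with (Series (fun n => / 2 * (/ 2) ^ n)).
    + apply Series_le; [apply dist_summand_bounds | apply ex_series_half].
    + rewrite Series_scal_l, Series_geom by (rewrite Rabs_pos_eq; lra); lra.
Qed.

(** Self-similarity of the metric under the shift; it lets the comparisons with powers of 1/2 go by
    induction on positions instead of through series. *)
Lemma dist_unfold (x y : nat -> nat) :
  dist x y = (delta (x 0%nat) (y 0%nat) + dist (shift x) (shift y)) / 2.
Proof.
  unfold dist at 1; rewrite Series_incr_1 by apply ex_series_dist.
  rewrite (Series_ext _ (fun n => / 2 *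
    (delta (shift x n) (shift y n) / 2 ^ Datatypes.S n))).
  - rewrite Series_scal_l; unfold dist; simpl; field.
  - intros n; unfold shift; simpl; field; apply pow_nonzero; lra.
Qed.

Lemma dist_agree (r : nat) (x y : nat -> nat) :
  (forall t, (t < r)%nat -> x t = y t) -> dist x y <= (/ 2) ^ r.
Proof.
  revert x y; induction r as [|r IH]; intros x y H; [apply dist_bounds |].
  rewrite dist_unfold; unfold delta; rewrite (H 0%nat) by lia.
  destruct (Nat.eq_dec (y 0%nat) (y 0%nat)) as [_ | E]; [|easy].
  specialize (IH (shift x) (shift y)); simpl; unfold Rdiv.
  enough (dist (shift x) (shift y) <= (/ 2) ^ r) by lra.
  apply IH; intros t Ht; apply H; lia.
Qed.

Lemma dist_differ (j : nat) (x y : nat -> nat) :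
  x j <> y j -> (/ 2) ^ Datatypes.S j <= dist x y.
Proof.
  revert x y; induction j as [|j IH]; intros x y H; rewrite dist_unfold.
  - assert (B := dist_bounds (shift x) (shift y)); unfold delta.
    destruct (Nat.eq_dec (x 0%nat) (y 0%nat)); [easy | simpl; lra].
  - specialize (IH (shift x) (shift y) H).
    unfold delta; destruct (Nat.eq_dec (x 0%nat) (y 0%nat)); simpl in *; lra.
Qed.

Lemma dist_small_agree (r : nat) (x y : nat -> nat) :
  dist x y < (/ 2) ^ r -> forall t, (t < r)%nat -> x t = y t.
Proof.
  intros H t Ht; destruct (Nat.eq_dec (x t) (y t)) as [E | E]; [exact E | exfalso].
  apply dist_differ in E.
  assert (P : (/ 2) ^ r <= (/ 2) ^ Datatypes.S t); [|lra].
  rewrite !pow_inv; apply Rinv_le_contravar; [apply pow_lt; lra |].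
  apply Rle_pow; [lra | lia].
Qed.

Lemma half_pow_small (eps : R) : 0 < eps -> exists r, (/ 2) ^ r < eps.
Proof.
  intros H; destruct (pow_lt_1_zero (/ 2)) with (y := eps) as [N HN].
  - rewrite Rabs_pos_eq; lra.
  - exact H.
  - exists N; specialize (HN N (le_n N)); rewrite Rabs_pos_eq in HN; [exact HN |].
    apply pow_le; lra.
Qed.

Lemma half_pow_pos (r : nat) : 0 < (/ 2) ^ r.
Proof. apply pow_lt; lra. Qed.

(** * The two limits in the definition of DC1 *)

Lemma LimInf_Phi_zero (x y : nat -> nat) (t : R) :
  (forall K N, exists n, (N <= n)%nat /\ (1 <= n)%nat /\
     (K * cnt (fun i => dist (shiftn i x) (shiftn i y) < t)%R 0 n <= n)%nat) ->
  LimInf_seq (Phi x y t) = 0.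
Proof.
  intros H; apply is_LimInf_seq_unique; intros eps; split.
  - intros N; destruct (archimed_cor1 eps (cond_pos eps)) as [K [HK HK0]].
    destruct (H K N) as [n [Hn [Hn1 Hc]]]; exists n; split; [exact Hn |].
    rewrite Rplus_0_l; apply Rle_lt_trans with (/ INR K); [|exact HK].
    assert (0 < INR n) by (apply lt_0_INR; lia).
    assert (0 < INR K) by (apply lt_0_INR; lia).
    unfold Phi; apply Rle_div_l; [lra |].
    apply Rmult_le_reg_l with (INR K); [lra |].
    rewrite <- Rmult_assoc, Rinv_r, Rmult_1_l, <- mult_INR by lra.
    apply le_INR, Hc.
  (* This half is automatic: [Phi] is a ratio and lies in [0, 1]. *)
  - exists 0%nat; intros n _; assert (E := cond_pos eps).
    destruct (ratio_bounds (fun i => dist (shiftn i x) (shiftn i y) < t)%R 0 n).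
    unfold Phi; unfold ratio in *; lra.
Qed.

Lemma LimSup_Phi_one (x y : nat -> nat) (t : R) :
  (forall K N, exists n, (N <= n)%nat /\ (1 <= n)%nat /\
     (K * n <= K * cnt (fun i => dist (shiftn i x) (shiftn i y) < t)%R 0 n + n)%nat) ->
  LimSup_seq (Phi x y t) = 1.
Proof.
  intros H; apply is_LimSup_seq_unique; intros eps; split.
  - intros N; destruct (archimed_cor1 eps (cond_pos eps)) as [K [HK HK0]].
    destruct (H K N) as [n [Hn [Hn1 Hc]]]; exists n; split; [exact Hn |].
    apply Rlt_le_trans with (1 - / INR K); [lra |].
    assert (0 < INR n) by (apply lt_0_INR; lia).
    assert (0 < INR K) by (apply lt_0_INR; lia).
    unfold Phi; apply Rle_div_r; [lra |].
    apply Rmult_le_reg_l with (INR K); [lra |].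
    apply le_INR in Hc; rewrite plus_INR, !mult_INR in Hc.
    replace (INR K * ((1 - / INR K) * INR n)) with (INR K * INR n - INR n)
      by (field; lra).
    lra.
  - exists 0%nat; intros n _; assert (E := cond_pos eps).
    destruct (ratio_bounds (fun i => dist (shiftn i x) (shiftn i y) < t)%R 0 n).
    unfold Phi; unfold ratio in *; lra.
Qed.

Local Open Scope nat_scope.

(** * The construction *)

Fixpoint len (l0 n : nat) : nat :=
  match n with
  | 0 => l0
  | S n' => (2 * n' + 7) * len l0 n'
  end.

(** The block symbols [b n' j] and the flag [fl] of the special block stay free, so that one
    analysis serves all cases and all parameters. *)
Fixpoint word (l0 : nat) (w : nat -> nat) (b : nat -> nat -> nat) (fl : bool)
  (n i : nat) : nat :=
  match n with
  | 0 => w i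
  | S n' =>
      let L := len l0 n' in
      let j := i / L in
      if j =? 0 then word l0 w b fl n' i
      else if j <=? 2 * n' + 4 then b n' j
      else if j =? 2 * n' + 5 then (if fl then (i mod L) mod 2 else 0)
      else word l0 w b fl n' (i mod L)
  end.

(** For positive [l0], stage [i] already determines coordinate [i], because [i < len l0 i]; later
    stages agree with it by [word_coherent]. *)
Definition point (l0 : nat) (w : nat -> nat) (b : nat -> nat -> nat) (fl : bool)
  (i : nat) : nat := word l0 w b fl i i.

Section Construction.
Context (l0 : nat) (w : nat -> nat) (b : nat -> nat -> nat) (fl : bool).
Context (l0_pos : 1 <= l0).

Local Notation L := (len l0).
Local Notation x := (point l0 w b fl).

Lemma len_gt (n : nat) : n < L n.
Proof. induction n as [|n IH]; simpl; nia. Qed.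

Lemma len_mono (n d : nat) : L n <= L (n + d).
Proof.
  induction d as [|d IH]; [rewrite Nat.add_0_r; lia |].
  rewrite Nat.add_succ_r; simpl; nia.
Qed.

Lemma len_divides (n d : nat) : exists q, L (n + d) = q * L n.
Proof.
  induction d as [|d [q IH]]; [exists 1; rewrite Nat.add_0_r; lia |].
  exists ((2 * (n + d) + 7) * q); rewrite Nat.add_succ_r; simpl len; rewrite IH; lia.
Qed.

Lemma word_coherent (n d i : nat) :
  i < L n -> word l0 w b fl (n + d) i = word l0 w b fl n i.
Proof.
  intros H; induction d as [|d IH]; [now rewrite Nat.add_0_r |].
  rewrite Nat.add_succ_r; cbn [word].
  rewrite Nat.div_small by (assert (M := len_mono n d); lia); exact IH.
Qed.

Lemma point_word (n i : nat) : i < L n -> x i = word l0 w b fl n i.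
Proof.
  intros H; unfold point; destruct (Nat.le_ge_cases n i) as [E | E].
  - replace i with (n + (i - n)) at 1 by lia; apply word_coherent, H.
  - replace n with (i + (n - i)) by lia; symmetry; apply word_coherent, len_gt.
Qed.

Lemma block_div (n j r : nat) : r < L n -> (j * L n + r) / L n = j.
Proof.
  intros H; rewrite Nat.div_add_l by lia; rewrite Nat.div_small by lia; lia.
Qed.

Lemma block_mod (n j r : nat) : r < L n -> (j * L n + r) mod L n = r.
Proof.
  intros H; rewrite Nat.add_comm, Nat.Div0.mod_add; apply Nat.mod_small, H.
Qed.

Lemma point_prefix (i : nat) : i < l0 -> x i = w i.
Proof. intros H; now rewrite (point_word 0). Qed.

Lemma point_base (n j r : nat) :
  1 <= j <= 2 * n + 4 -> r < L n -> x (j * L n + r) = b n j.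
Proof.
  intros Hj Hr; rewrite (point_word (S n)) by (simpl; nia).
  cbn [word]; rewrite block_div by exact Hr.
  destruct (Nat.eqb_spec j 0); [lia |].
  destruct (Nat.leb_spec j (2 * n + 4)); [reflexivity | lia].
Qed.

Lemma point_special (n r : nat) :
  r < L n -> x ((2 * n + 5) * L n + r) = if fl then r mod 2 else 0.
Proof.
  intros Hr; rewrite (point_word (S n)) by (simpl; nia).
  cbn [word]; rewrite block_div, block_mod by exact Hr.
  destruct (Nat.eqb_spec (2 * n + 5) 0); [lia |].
  destruct (Nat.leb_spec (2 * n + 5) (2 * n + 4)); [lia |].
  now rewrite Nat.eqb_refl.
Qed.

Lemma point_copy (n r : nat) : r < L n -> x ((2 * n + 6) * L n + r) = x r.
Proof.
  intros Hr; rewrite (point_word (S n)) by (simpl; nia).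
  rewrite (point_word n r Hr).
  cbn [word]; rewrite block_div, block_mod by exact Hr.
  destruct (Nat.eqb_spec (2 * n + 6) 0); [lia |].
  destruct (Nat.leb_spec (2 * n + 6) (2 * n + 4)); [lia |].
  destruct (Nat.eqb_spec (2 * n + 6) (2 * n + 5)); [lia | reflexivity].
Qed.

Lemma point_lt (k : nat) :
  2 <= k -> (forall i, i < l0 -> w i < k) -> (forall n j, b n j <= 1) ->
  InSigma k x.
Proof.
  intros Hk Hw Hb.
  assert (H : forall n i, i < L n -> x i < k).
  { induction n as [|n IH]; intros i Hi.
    - simpl in Hi; rewrite point_prefix by exact Hi; apply Hw, Hi.
    - assert (HL := len_gt n).
      assert (Hm := Nat.mod_upper_bound i (L n) ltac:(lia)).
      assert (E := Nat.div_mod_eq i (L n)).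
      set (j := i / L n) in *; set (r := i mod L n) in *.
      rewrite Nat.mul_comm in E.
      assert (Hj : j < 2 * n + 7) by (simpl in Hi; nia).
      rewrite E.
      destruct (Nat.eq_dec j 0) as [-> | J0]; [apply IH; lia |].
      destruct (Nat.le_gt_cases j (2 * n + 4)) as [J1 | J1].
      + rewrite point_base by lia; specialize (Hb n j); lia.
      + destruct (Nat.eq_dec j (2 * n + 5)) as [-> | J2].
        * rewrite point_special by lia; destruct fl; [|lia].
          assert (B := Nat.mod_upper_bound r 2 ltac:(lia)); lia.
        * replace j with (2 * n + 6) by lia; rewrite point_copy by lia; apply IH; lia. }
  intros i; apply (H i), len_gt.
Qed.

(** Induction on the number [d] of stages needed to reach the block. It lies inside one block of
    stage [n + d]: a base or special block settles it, and the initial or final copy sends it back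
    to an earlier stage. The phase [s] is needed since [L n] may be odd, so that an alternating
    block can begin with either symbol. *)
Lemma point_blocks (n j : nat) :
  (forall r, r < L n -> x (j * L n + r) = x r) \/
  (exists n' j', forall r, r < L n -> x (j * L n + r) = b n' j') \/
  (exists s, forall r, r < L n ->
     x (j * L n + r) = if fl then (s + r) mod 2 else 0).
Proof.
  enough (H : forall d j, j * L n < L (n + d) ->
    (forall r, r < L n -> x (j * L n + r) = x r) \/
    (exists n' j', forall r, r < L n -> x (j * L n + r) = b n' j') \/
    (exists s, forall r, r < L n ->
       x (j * L n + r) = if fl then (s + r) mod 2 else 0)).
  { apply (H (j * L n)).
    assert (G := len_gt (j * L n)); assert (M := len_mono (j * L n) n).
    rewrite (Nat.add_comm n); lia. }
  clear j; assert (HL := len_gt n).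
  induction d as [|d IH]; intros j Hj.
  - rewrite Nat.add_0_r in Hj; assert (j = 0) by nia; subst j.
    left; intros r Hr; reflexivity.
  - rewrite Nat.add_succ_r in Hj; simpl in Hj.
    destruct (len_divides n d) as [q Hq].
    assert (HM := len_gt (n + d)).
    assert (Hq0 : 0 < q) by nia.
    assert (Hm := Nat.mod_upper_bound j q ltac:(lia)).
    assert (E := Nat.div_mod_eq j q).
    (* [J] is the large block of length [L (n + d)] containing the given one, and [s] is the place
       inside it, counted in blocks of length [L n]. *)
    set (J := j / q) in *; set (s := j mod q) in *.
    assert (HJ : J < 2 * (n + d) + 7).
    { apply Nat.nle_gt; intros C.
      assert ((2 * (n + d) + 7) * q <= j) by nia.
      assert ((2 * (n + d) + 7) * L (n + d) <= j * L n)
        by (rewrite Hq, Nat.mul_assoc; apply Nat.mul_le_mono_r; assumption).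
      lia. }
    assert (Es : forall r, j * L n + r = J * L (n + d) + (s * L n + r))
      by (intros r; rewrite Hq, E; lia).
    assert (Hs : forall r, r < L n -> s * L n + r < L (n + d))
      by (intros r Hr; rewrite Hq; nia).
    destruct (Nat.eq_dec J 0) as [J0 | J0].
    { replace j with s by lia; apply IH; specialize (Hs 0); lia. }
    destruct (Nat.le_gt_cases J (2 * (n + d) + 4)) as [J1 | J1].
    { right; left; exists (n + d), J; intros r Hr; rewrite Es.
      apply point_base; [lia | apply Hs, Hr]. }
    destruct (Nat.eq_dec J (2 * (n + d) + 5)) as [J2 | J2].
    { right; right; exists (s * L n); intros r Hr; rewrite Es, J2.
      apply point_special, Hs, Hr. }
    assert (Ec : forall r, r < L n -> x (j * L n + r) = x (s * L n + r)).
    { intros r Hr; rewrite Es; replace J with (2 * (n + d) + 6) by lia.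
      apply point_copy, Hs, Hr. }
    destruct (IH s) as [H | [[n' [j' H]] | [s' H]]].
    + specialize (Hs 0); lia.
    + left; intros r Hr; rewrite Ec by exact Hr; apply H, Hr.
    + right; left; exists n', j'; intros r Hr; rewrite Ec by exact Hr; apply H, Hr.
    + right; right; exists s'; intros r Hr; rewrite Ec by exact Hr; apply H, Hr.
Qed.

End Construction.

(** * Counting *)

(** Density zero without division; [Banach_null] is the version uniform in the start of the
    window. *)
Definition upper_null (Z : nat -> Prop) : Prop :=
  forall K, exists N0, forall N, N0 <= N -> 1 <= N -> K * cnt Z 0 N < N.

Definition Banach_null (Z : nat -> Prop) : Prop :=
  forall K, exists N0, forall N m, N0 <= N -> 1 <= N -> K * cnt Z m N < N.

Lemma upper_null_not_pos (S Z : nat -> Prop) (c : nat) :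
  upper_null Z -> (forall i, S i -> Z (i + c)) -> ~ Rbar_lt 0%R (upper_density S).
Proof.
  intros HZ HS Hp; apply upper_density_pos in Hp; destruct Hp as [K HK].
  (* The shift enlarges the prefix from [n] to [c + n], which is at most [2 * n]; the factor 2 pays
     for this. *)
  destruct (HZ (2 * K)) as [N0 HN0].
  destruct (HK (N0 + c)) as [n [Hn Hc]].
  assert (H1 : cnt S 0 n <= cnt Z c n)
    by (apply cnt_shift_le; intros i _ Hi; rewrite (Nat.add_comm c); apply HS, Hi).
  assert (H2 := cnt_add Z 0 c n); simpl in H2.
  specialize (HN0 (c + n)); nia.
Qed.

Lemma Banach_null_not_pos (S Z : nat -> Prop) (c : nat) :
  Banach_null Z -> (forall i, S i -> Z (i + c)) -> ~ Rbar_lt 0%R (upper_Banach S).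
Proof.
  intros HZ HS Hp; apply upper_Banach_pos in Hp; destruct Hp as [K HK].
  destruct (HZ K) as [N0 HN0].
  destruct (HK N0) as [n [m [Hn Hc]]].
  assert (H1 : cnt S m n <= cnt Z (m + c) n).
  { apply cnt_shift_le; intros i _ Hi.
    replace (m + c + i) with (m + i + c) by lia; apply HS, Hi. }
  specialize (HN0 n (m + c)); nia.
Qed.

(** Combinatorial counterpart of a visit to a ball around [y]; [1 <= i] matches the positive times
    in [Nset]. *)
Definition occ (y : nat -> nat) (r : nat) (z : nat -> nat) (i : nat) : Prop :=
  1 <= i /\ forall t, t < r -> z (i + t) = y t.

Section Counting.
Context (l0 : nat) (w : nat -> nat) (b : nat -> nat -> nat) (fl : bool).
Context (l0_pos : 1 <= l0).

Local Notation L := (len l0).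
Local Notation x := (point l0 w b fl).

(** Measures [N] on the scale of the stage containing it; the quotient is at most [2 * n + 6]
    because stage [n] has [2 * n + 7] blocks. *)
Lemma level_decomposition (n0 N : nat) :
  L n0 <= N ->
  exists n j r, n0 <= n /\ N = j * L n + r /\ r < L n /\ 1 <= j <= 2 * n + 6.
Proof.
  intros H0.
  assert (H : forall d, N < L (n0 + d) -> exists n, n0 <= n /\ L n <= N < L (S n)).
  { induction d as [|d IH]; [rewrite Nat.add_0_r; lia | intros Hd].
    destruct (Nat.le_gt_cases (L (n0 + d)) N) as [E | E]; [|apply IH, E].
    exists (n0 + d); rewrite Nat.add_succ_r in Hd; lia. }
  destruct (H N) as [n [Hn [H1 H2]]].
  { assert (G := len_gt l0 l0_pos N); assert (M := len_mono l0 l0_pos N n0).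
    rewrite Nat.add_comm; lia. }
  assert (HL := len_gt l0 l0_pos n).
  assert (Hm := Nat.mod_upper_bound N (L n) ltac:(lia)).
  assert (E := Nat.div_mod_eq N (L n)).
  exists n, (N / L n), (N mod L n); simpl in H2.
  repeat split; try lia; nia.
Qed.

(** * Rarity of a three-symbol pattern that constant blocks avoid *)

Section Bad.
Context (P : nat -> nat -> nat -> Prop).
Local Notation Z := (fun i => P (x i) (x (i + 1)) (x (i + 2))).

(** Only the last two starting positions can see symbols beyond the window. *)
Lemma cnt_flat (m N : nat) :
  (forall r, r + 2 < N -> ~ P (x (m + r)) (x (m + (r + 1))) (x (m + (r + 2)))) ->
  cnt Z m N <= 2.
Proof.
  intros H; destruct (Nat.le_gt_cases N 2) as [E | E].
  - assert (C := cnt_le Z m N); lia.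
  - replace N with ((N - 2) + 2) by lia; rewrite cnt_add, cnt_none.
    + apply cnt_le.
    + intros i Hi; rewrite <- !Nat.add_assoc; apply H; lia.
Qed.

Lemma cnt_bad_copy (m m' N : nat) :
  (forall r, r < N -> x (m + r) = x (m' + r)) -> cnt Z m N <= cnt Z m' N + 2.
Proof.
  intros H; destruct (Nat.le_gt_cases N 2) as [E | E].
  - assert (C := cnt_le Z m N); lia.
  - assert (C := cnt_le_prefix Z m' (N - 2) N ltac:(lia)).
    replace N with ((N - 2) + 2) at 1 by lia; rewrite cnt_add.
    assert (D := cnt_le Z (m + (N - 2)) 2).
    enough (cnt Z m (N - 2) <= cnt Z m' (N - 2)) by lia.
    apply cnt_shift_le; intros i Hi; rewrite <- !Nat.add_assoc, !H by lia; easy.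
Qed.

Context (base_good : forall n j, ~ P (b n j) (b n j) (b n j)).

Lemma cnt_bad_base (n j : nat) :
  1 <= j <= 2 * n + 4 -> cnt Z (j * L n) (L n) <= 2.
Proof.
  intros Hj; apply cnt_flat; intros r Hr; rewrite !point_base by lia; apply base_good.
Qed.

(** One stage roughly doubles the count, through the two copies of the word, and adds border terms
    and the whole special block, while the length is multiplied by [2 * n + 7]. Charging the special
    block in full makes the bound valid for both values of [fl]. *)
Lemma cnt_bad_prefix (n : nat) : (n + 1) * cnt Z 0 (L n) <= 10 * L n.
Proof.
  induction n as [|n IH]; [assert (C := cnt_le Z 0 (L 0)); lia |].
  assert (HL := len_gt l0 l0_pos n).
  assert (E : L (S n) = L n + (2 * n + 4) * L n + L n + L n) by (simpl; lia).
  assert (H1 : cnt Z (L n) ((2 * n + 4) * L n) <= (2 * n + 4) * 2).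
  { apply cnt_blocks_le; intros j Hj.
    replace (L n + j * L n) with ((j + 1) * L n) by lia; apply cnt_bad_base; lia. }
  assert (H2 := cnt_le Z (L n + (2 * n + 4) * L n) (L n)).
  assert (H3 : cnt Z (L n + (2 * n + 4) * L n + L n) (L n) <= cnt Z 0 (L n) + 2).
  { apply cnt_bad_copy; intros r Hr.
    replace (L n + (2 * n + 4) * L n + L n + r) with ((2 * n + 6) * L n + r) by lia.
    apply point_copy; assumption. }
  (* [4 * n + 10] allows two border positions for each of the [2 * n + 4] base blocks and for the
     final copy. *)
  assert (Hc : cnt Z 0 (L (S n)) <= 2 * cnt Z 0 (L n) + (4 * n + 10) + L n)
    by (rewrite E, !cnt_add, !Nat.add_0_l; lia).
  set (v := cnt Z 0 (L n)) in *.
  assert (H4 : (S n + 1) * cnt Z 0 (L (S n)) <= (n + 2) * (2 * v + (4 * n + 10) + L n))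
    by (replace (S n + 1) with (n + 2) by lia; apply Nat.mul_le_mono_l; exact Hc).
  assert (H5 : (n + 2) * v <= 2 * ((n + 1) * v)) by nia.
  assert (H6 : (n + 2) * (4 * n + 10) <= 4 * (2 * n + 7) * L n).
  { apply Nat.le_trans with (4 * (2 * n + 7) * (n + 1)); [nia |].
    apply Nat.mul_le_mono_l; lia. }
  lia.
Qed.

Lemma bad_upper_null : upper_null Z.
Proof.
  intros K; exists (L (46 * K)); intros N HN HN1.
  destruct (level_decomposition _ _ HN) as [n [j [r [Hn [E [Hr Hj]]]]]].
  assert (HL := len_gt l0 l0_pos n).
  assert (Hv := cnt_bad_prefix n).
  assert (Hbase : forall i, i <= 2 * n + 4 -> cnt Z (L n) (i * L n) <= i * 2).
  { intros i Hi; apply cnt_blocks_le; intros s Hs.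
    replace (L n + s * L n) with ((s + 1) * L n) by lia; apply cnt_bad_base; lia. }
  assert (HJ : (n + 1) * cnt Z 0 ((j + 1) * L n) <= 23 * ((j + 1) * L n)).
  { destruct (Nat.le_gt_cases j (2 * n + 4)) as [J1 | J1].
    - replace ((j + 1) * L n) with (L n + j * L n) by lia.
      rewrite cnt_add, !Nat.add_0_l; specialize (Hbase j J1).
      assert ((n + 1) * cnt Z (L n) (j * L n) <= (n + 1) * (j * 2))
        by (apply Nat.mul_le_mono_l; exact Hbase).
      assert ((n + 1) * j <= L n * j) by (apply Nat.mul_le_mono_r; lia).
      lia.
    (* Past the base blocks the special block counts in full, but at least [(2 * n + 6) * L n]
       positions are there to absorb it. *)
    - specialize (Hbase (2 * n + 4) (le_n _)).
      assert (H2 := cnt_le Z (L n + (2 * n + 4) * L n) (L n)).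
      assert (H3 : cnt Z (L n + (2 * n + 4) * L n + L n) (L n) <= cnt Z 0 (L n) + 2).
      { apply cnt_bad_copy; intros s Hs.
        replace (L n + (2 * n + 4) * L n + L n + s) with ((2 * n + 6) * L n + s) by lia.
        apply point_copy; assumption. }
      assert (C := cnt_le_prefix Z 0 ((j + 1) * L n) ((2 * n + 7) * L n)
        ltac:(apply Nat.mul_le_mono_r; lia)).
      replace ((2 * n + 7) * L n) with (L n + (2 * n + 4) * L n + L n + L n) in C by lia.
      rewrite !cnt_add, !Nat.add_0_l in C.
      assert ((n + 1) * cnt Z 0 ((j + 1) * L n) <=
        (n + 1) * (2 * cnt Z 0 (L n) + (4 * n + 10) + L n))
        by (apply Nat.mul_le_mono_l; lia).
      assert ((2 * n + 6) * L n <= (j + 1) * L n) by (apply Nat.mul_le_mono_r; lia).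
      nia. }
  assert (C := cnt_le_prefix Z 0 N ((j + 1) * L n) ltac:(lia)).
  (* Rounding [N] up to [j + 1] blocks at most doubles it, as [1 <= j]; so 23 becomes 46. *)
  assert (Hfin : (n + 1) * cnt Z 0 N <= 46 * N) by nia.
  assert (H46 : (46 * K + 1) * cnt Z 0 N <= 46 * N) by nia.
  destruct (Nat.eq_dec (cnt Z 0 N) 0) as [-> | Hz]; nia.
Qed.

Context (special_good : forall s,
  ~ P (if fl then s mod 2 else 0) (if fl then (s + 1) mod 2 else 0)
      (if fl then (s + 2) mod 2 else 0)).

(** By [point_blocks] the block is constant, alternating or zero, where only borders count, or a
    copy of its word. In a copy the base and special sub-blocks are flat, and the two outer
    sub-blocks are aligned blocks one stage lower. *)
Lemma cnt_bad_block (n j : nat) : (n + 1) * cnt Z (j * L n) (L n) <= 8 * L n.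
Proof.
  revert j; induction n as [|n IH]; intros j;
    [assert (C := cnt_le Z (j * L 0) (L 0)); lia |].
  assert (HL := len_gt l0 l0_pos n).
  assert (HL' := len_gt l0 l0_pos (S n)).
  destruct (point_blocks l0 w b fl l0_pos (S n) j) as [H | [[n' [j' H]] | [s H]]].
  - assert (E : L (S n) = L n + (2 * n + 4) * L n + L n + L n) by (simpl; lia).
    set (m := j * L (S n)) in *.
    assert (Em : forall i, m + i * L n = (j * (2 * n + 7) + i) * L n)
      by (intros i; unfold m; simpl; lia).
    (* The induction hypothesis is used at the actual positions of the outer sub-blocks, so patterns
       running over their right ends are already counted. *)
    assert (H0 := IH (j * (2 * n + 7) + 0)).
    rewrite <- Em in H0; simpl (0 * _) in H0; rewrite Nat.add_0_r in H0.
    assert (H3 := IH (j * (2 * n + 7) + (2 * n + 6))).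
    rewrite <- Em in H3.
    assert (H1 : cnt Z (m + L n) ((2 * n + 4) * L n) <= (2 * n + 4) * 2).
    { apply cnt_blocks_le; intros i Hi; apply cnt_flat; intros r Hr.
      assert (Ei : forall t, m + L n + i * L n + t = m + ((i + 1) * L n + t)) by (intros; lia).
      rewrite !Ei, !H by (rewrite E; nia).
      rewrite !point_base by lia; apply base_good. }
    assert (H2 : cnt Z (m + (L n + (2 * n + 4) * L n)) (L n) <= 2).
    { apply cnt_flat; intros r Hr.
      assert (Ei : forall t, m + (L n + (2 * n + 4) * L n) + t = m + ((2 * n + 5) * L n + t))
        by (intros; lia).
      rewrite !Ei, !H by (rewrite E; nia).
      rewrite !point_special by lia; apply special_good. }
    replace (m + (2 * n + 6) * L n)
      with (m + (L n + (2 * n + 4) * L n + L n)) in H3 by lia.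
    rewrite E at 1; rewrite !cnt_add.
    replace (L (S n)) with ((2 * n + 7) * L n) by (simpl; lia).
    nia.
  - assert (C : cnt Z (j * L (S n)) (L (S n)) <= 2); [|nia].
    apply cnt_flat; intros r Hr; rewrite !H by lia; apply base_good.
  - assert (C : cnt Z (j * L (S n)) (L (S n)) <= 2); [|nia].
    apply cnt_flat; intros r Hr; rewrite !H by lia; rewrite !Nat.add_assoc.
    apply special_good.
Qed.

Lemma bad_Banach_null : Banach_null Z.
Proof.
  intros K; set (n := 16 * K); exists (2 * L n); intros N m HN HN1.
  assert (HL := len_gt l0 l0_pos n).
  assert (Hm := Nat.mod_upper_bound m (L n) ltac:(lia)).
  assert (E := Nat.div_mod_eq m (L n)).
  assert (HNm := Nat.mod_upper_bound N (L n) ltac:(lia)).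
  assert (EN := Nat.div_mod_eq N (L n)).
  set (j := m / L n) in *; set (r := m mod L n) in *.
  set (q := N / L n) in *; set (s := N mod L n) in *.
  (* The window is covered by [q + 2] aligned blocks; the two extra ones cost no more than [N]
     positions since [2 * L n <= N], which turns 8 into 16. *)
  assert (Hb : cnt Z (j * L n) ((q + 2) * L n) <= (q + 2) * (8 * L n / (n + 1))).
  { apply cnt_blocks_le; intros i _.
    replace (j * L n + i * L n) with ((j + i) * L n) by lia.
    apply Nat.div_le_lower_bound; [lia | apply cnt_bad_block]. }
  assert (HB := Nat.Div0.mul_div_le (8 * L n) (n + 1)).
  assert (C := cnt_le_prefix Z (j * L n) (r + N) ((q + 2) * L n) ltac:(lia)).
  rewrite cnt_add in C; replace (j * L n + r) with m in C by lia.
  assert (Hc : (n + 1) * cnt Z m N <= 16 * N).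
  { apply Nat.le_trans with ((n + 1) * ((q + 2) * (8 * L n / (n + 1))));
      [apply Nat.mul_le_mono_l; lia |].
    rewrite Nat.mul_assoc, (Nat.mul_comm (n + 1)), <- Nat.mul_assoc.
    apply Nat.le_trans with ((q + 2) * (8 * L n));
      [apply Nat.mul_le_mono_l; exact HB | lia]. }
  unfold n in Hc; destruct (Nat.eq_dec (cnt Z m N) 0) as [-> | Hz]; nia.
Qed.

End Bad.

(** * Occurrences of constant and alternating words *)

Lemma cnt_occ_block (y : nat -> nat) (r n j : nat) :
  1 <= j -> (forall s, s < L n -> x (j * L n + s) = y 0) -> (forall t, y t = y 0) ->
  L n - r <= cnt (occ y r x) (j * L n) (L n).
Proof.
  intros Hj H Hy; assert (HL := len_gt l0 l0_pos n).
  assert (C := cnt_le_prefix (occ y r x) (j * L n) (L n - r) (L n) ltac:(lia)).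
  rewrite cnt_full in C; [exact C |].
  intros i Hi; split; [nia |].
  intros t Ht; rewrite Hy, <- Nat.add_assoc; apply H; lia.
Qed.

(** The base blocks form [n + 2] consecutive pairs, and each must contain a block of [c]. Thus [c]
    is frequent throughout the stage and not only at its end, as lower density requires. *)
Definition rich (c n : nat) : Prop :=
  forall t, t < n + 2 -> b n (2 * t + 1) = c \/ b n (2 * t + 2) = c.

Lemma rich_count (y : nat -> nat) (r n T : nat) :
  rich (y 0) n -> (forall t, y t = y 0) -> T <= n + 2 ->
  T * (L n - r) <= cnt (occ y r x) (L n) (T * (2 * L n)).
Proof.
  intros Hr Hy HT; apply cnt_blocks_ge; intros t Ht.
  replace (2 * L n) with (L n + L n) by lia; rewrite cnt_add.
  replace (L n + t * (L n + L n)) with ((2 * t + 1) * L n) by lia.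
  replace ((2 * t + 1) * L n + L n) with ((2 * t + 2) * L n) by lia.
  destruct (Hr t ltac:(lia)) as [E | E].
  - enough (L n - r <= cnt (occ y r x) ((2 * t + 1) * L n) (L n)) by lia.
    apply cnt_occ_block; [lia | | exact Hy].
    intros s Hs; rewrite point_base by lia; exact E.
  - enough (L n - r <= cnt (occ y r x) ((2 * t + 2) * L n) (L n)) by lia.
    apply cnt_occ_block; [lia | | exact Hy].
    intros s Hs; rewrite point_base by lia; exact E.
Qed.

Lemma rich_upper_density (y : nat -> nat) (r : nat) :
  (forall t, y t = y 0) -> (forall N, exists n, N <= n /\ rich (y 0) n) ->
  Rbar_lt 0%R (upper_density (occ y r x)).
Proof.
  intros Hy Hr; apply upper_density_pos; exists 8; intros N.
  destruct (Hr (N + 2 * r)) as [n [Hn Hn']].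
  assert (HL := len_gt l0 l0_pos n).
  exists (L n + (n + 2) * (2 * L n)).
  assert (C := rich_count y r n (n + 2) Hn' Hy (le_n _)).
  rewrite cnt_add, !Nat.add_0_l; nia.
Qed.

Lemma rich_lower_density (y : nat -> nat) (r : nat) :
  (forall t, y t = y 0) -> (forall n, rich (y 0) n) ->
  Rbar_lt 0%R (lower_density (occ y r x)).
Proof.
  (* The threshold puts [N] in a stage beyond [2 * r], so that in this stage and in its predecessor
     [r] is less than half a block. *)
  intros Hy Hr; apply lower_density_pos; exists 40, (L (S (2 * r))); intros N HN.
  destruct (level_decomposition _ _ HN) as [n [j [s [Hn [E [Hs Hj]]]]]].
  assert (HL := len_gt l0 l0_pos n).
  destruct (Nat.le_gt_cases 5 j) as [J | J].
  (* After five blocks the completed pairs of the current stage suffice. *)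
  - assert (D := Nat.div_mod_eq (j - 1) 2).
    assert (D' := Nat.mod_upper_bound (j - 1) 2 ltac:(lia)).
    set (T := (j - 1) / 2) in *.
    assert (C := rich_count y r n T (Hr n) Hy ltac:(lia)).
    assert (C' := cnt_le_prefix (occ y r x) 0 (L n + T * (2 * L n)) N ltac:(nia)).
    rewrite cnt_add, !Nat.add_0_l in C'.
    assert (N <= (2 * T + 3) * L n) by nia.
    nia.
  (* Early in a stage the pairs of the whole preceding stage are used: they fill a fixed fraction of
     [L (S n)], and [N < 5 * L (S n)]. *)
  - destruct n as [|n]; [lia |].
    assert (HL' := len_gt l0 l0_pos n).
    assert (C := rich_count y r n (n + 2) (Hr n) Hy (le_n _)).
    assert (EL : L (S n) = (2 * n + 7) * L n) by reflexivity.
    assert (C' := cnt_le_prefix (occ y r x) 0 (L n + (n + 2) * (2 * L n)) N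
      ltac:(rewrite EL in E; nia)).
    rewrite cnt_add, !Nat.add_0_l in C'.
    rewrite EL in *; nia.
Qed.

(** When the base blocks of a stage without [c] end, only the initial word, a fraction
    [1 / (2 * n + 5)] of the prefix, can have contributed. *)
Lemma poor_lower_density (S : nat -> Prop) (c : nat) :
  (forall N, exists n, N <= n /\ forall j, 1 <= j <= 2 * n + 4 -> b n j <> c) ->
  (forall i, S i -> x i = c) -> ~ Rbar_lt 0%R (lower_density S).
Proof.
  intros Hp HS H; apply lower_density_pos in H; destruct H as [K [N H]].
  destruct (Hp (K + N)) as [n [Hn Hb]]; assert (HL := len_gt l0 l0_pos n).
  specialize (H (L n + (2 * n + 4) * L n) ltac:(nia)).
  rewrite cnt_add, !Nat.add_0_l in H.
  assert (C := cnt_le S 0 (L n)).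
  assert (C' : cnt S (L n) ((2 * n + 4) * L n) <= (2 * n + 4) * 0).
  { apply cnt_blocks_le; intros j Hj; rewrite cnt_none; [lia |].
    intros i Hi Hx; apply HS in Hx; apply (Hb (j + 1)); [lia |].
    rewrite <- Hx; replace (L n + j * L n + i) with ((j + 1) * L n + i) by lia.
    symmetry; apply point_base; lia. }
  nia.
Qed.

(** One block without [c] in arbitrarily late stages already gives arbitrarily long gaps. *)
Lemma gap_lower_Banach (S : nat -> Prop) (c : nat) :
  (forall N, exists n j, N <= n /\ 1 <= j <= 2 * n + 4 /\ b n j <> c) ->
  (forall i, S i -> x i = c) -> ~ Rbar_lt 0%R (lower_Banach S).
Proof.
  intros Hp HS H; apply lower_Banach_pos in H; destruct H as [K [N H]].
  destruct (Hp N) as [n [j [Hn [Hj Hb]]]]; assert (HL := len_gt l0 l0_pos n).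
  specialize (H (L n) (j * L n) ltac:(lia)).
  rewrite cnt_none in H; [lia |].
  intros i Hi Hx; apply HS in Hx; apply Hb; rewrite <- Hx.
  symmetry; apply point_base; lia.
Qed.

(** A special block begins with 0, so the word occurs at every even offset not too close to the end.
    Taking the block itself as window gives a proportion near 1/2. *)
Lemma alternating_upper_Banach (r : nat) :
  fl = true -> Rbar_lt 0%R (upper_Banach (occ (fun t => t mod 2) r x)).
Proof.
  intros Hfl; apply upper_Banach_pos; exists 8; intros N.
  set (n := N + 4 * r + 4); assert (HL := len_gt l0 l0_pos n).
  exists (L n), ((2 * n + 5) * L n); split; [lia |]; split; [lia |].
  assert (D := Nat.div_mod_eq (L n - r) 2).
  assert (D' := Nat.mod_upper_bound (L n - r) 2 ltac:(lia)).
  set (T := (L n - r) / 2) in *.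
  assert (C := cnt_le_prefix (occ (fun t => t mod 2) r x) ((2 * n + 5) * L n)
    (T * 2) (L n) ltac:(lia)).
  enough (T * 1 <= cnt (occ (fun t => t mod 2) r x) ((2 * n + 5) * L n) (T * 2)) by lia.
  apply cnt_blocks_ge; intros i Hi.
  apply Nat.le_trans with
    (cnt (occ (fun t => t mod 2) r x) ((2 * n + 5) * L n + i * 2) 1);
    [|apply cnt_le_prefix; lia].
  rewrite cnt_full; [lia |].
  intros [|i'] Hi'; [|lia]; split; [lia |].
  intros t Ht; rewrite <- !Nat.add_assoc, point_special, Hfl by lia.
  rewrite Nat.add_0_l, Nat.add_comm; apply Nat.Div0.mod_add.
Qed.

Lemma point_recurrent (r N : nat) : exists n, N <= n /\ occ x r x n.
Proof.
  set (n := N + r); assert (HL := len_gt l0 l0_pos n).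
  exists ((2 * n + 6) * L n); split; [nia |]; split; [nia |].
  intros t Ht; apply point_copy; lia.
Qed.

End Counting.

(** * Comparison of two points over one stage *)

Lemma cnt_agree_stage (l0 : nat) (w : nat -> nat) (b b' : nat -> nat -> nat)
  (fl : bool) (n r : nat) (S : nat -> Prop) :
  1 <= l0 ->
  (forall j, 1 <= j <= 2 * n + 4 -> b n j = b' n j) ->
  (forall i, (forall t, t < r ->
     point l0 w b fl (i + t) = point l0 w b' fl (i + t)) -> S i) ->
  (2 * n + 4) * len l0 n - r <= cnt S 0 (len l0 n + (2 * n + 4) * len l0 n).
Proof.
  intros Hl Hb HS; assert (HL := len_gt l0 Hl n).
  rewrite cnt_add, !Nat.add_0_l.
  (* The last [r] positions are dropped, since a comparison of [r] symbols from there may leave the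
     base blocks. *)
  assert (C := cnt_le_prefix S (len l0 n) ((2 * n + 4) * len l0 n - r)
    ((2 * n + 4) * len l0 n) ltac:(lia)).
  rewrite cnt_full in C; [lia |].
  intros i Hi; apply HS; intros t Ht.
  assert (Hm := Nat.mod_upper_bound (i + t) (len l0 n) ltac:(lia)).
  assert (E := Nat.div_mod_eq (i + t) (len l0 n)).
  set (j := (i + t) / len l0 n) in *; set (s := (i + t) mod len l0 n) in *.
  replace (len l0 n + i + t) with ((j + 1) * len l0 n + s) by lia.
  assert (j < 2 * n + 4) by nia.
  rewrite !point_base by lia; apply Hb; lia.
Qed.

Lemma cnt_differ_stage (l0 : nat) (w : nat -> nat) (b b' : nat -> nat -> nat)
  (fl : bool) (n : nat) (S : nat -> Prop) :
  1 <= l0 ->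
  (forall j, 1 <= j <= 2 * n + 4 -> b n j <> b' n j) ->
  (forall i, S i -> point l0 w b fl i = point l0 w b' fl i) ->
  cnt S 0 (len l0 n + (2 * n + 4) * len l0 n) <= len l0 n.
Proof.
  intros Hl Hb HS; rewrite cnt_add, !Nat.add_0_l.
  assert (C := cnt_le S 0 (len l0 n)).
  assert (C' : cnt S (len l0 n) ((2 * n + 4) * len l0 n) <= (2 * n + 4) * 0);
    [|lia].
  apply cnt_blocks_le; intros j Hj; rewrite cnt_none; [lia |].
  intros i Hi Hx; apply HS in Hx; apply (Hb (j + 1)); [lia |].
  replace (len l0 n + j * len l0 n + i) with ((j + 1) * len l0 n + i) in Hx by lia.
  rewrite !point_base in Hx by lia; exact Hx.
Qed.

(** * The six cases *)

Definition monotone_density (xi : (nat -> Prop) -> Rbar) : Prop :=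
  forall S T : nat -> Prop, (forall i, S i -> T i) ->
    Rbar_lt 0%R (xi S) -> Rbar_lt 0%R (xi T).

Lemma cnt_mono (S T : nat -> Prop) (m n : nat) :
  (forall i, S i -> T i) -> cnt S m n <= cnt T m n.
Proof. intros H; apply cnt_shift_le; intros i _; apply H. Qed.

Lemma upper_density_mono : monotone_density upper_density.
Proof.
  intros S T H; rewrite !upper_density_pos; intros [K HK]; exists K; intros N.
  destruct (HK N) as [n Hn]; exists n.
  assert (C := cnt_mono S T 0 n H); nia.
Qed.

Lemma lower_density_mono : monotone_density lower_density.
Proof.
  intros S T H; rewrite !lower_density_pos; intros [K [N HK]].
  exists K, N; intros n Hn; specialize (HK n Hn).
  assert (C := cnt_mono S T 0 n H); nia.
Qed.

Lemma upper_Banach_mono : monotone_density upper_Banach.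
Proof.
  intros S T H; rewrite !upper_Banach_pos; intros [K HK]; exists K; intros N.
  destruct (HK N) as [n [m Hn]]; exists n, m.
  assert (C := cnt_mono S T m n H); nia.
Qed.

Lemma lower_Banach_mono : monotone_density lower_Banach.
Proof.
  intros S T H; rewrite !lower_Banach_pos; intros [K [N HK]].
  exists K, N; intros n m Hn; specialize (HK n m Hn).
  assert (C := cnt_mono S T m n H); nia.
Qed.

Lemma occ_of_Nset (k r i : nat) (x y : nat -> nat) :
  Nset x (ball k y ((/ 2) ^ r)%R) i -> occ y r x i.
Proof.
  intros [Hi [_ Hd]]; split; [exact Hi |].
  intros t Ht; rewrite (dist_small_agree r _ _ Hd t Ht); unfold shiftn; f_equal; lia.
Qed.

Lemma Nset_of_occ (k r i : nat) (x y : nat -> nat) (eps : R) :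
  InSigma k x -> ((/ 2) ^ r < eps)%R -> occ y r x i -> Nset x (ball k y eps) i.
Proof.
  intros Hx He [Hi H]; split; [exact Hi | split].
  - intros t; apply Hx.
  - eapply Rle_lt_trans; [apply (dist_agree r) | exact He].
    intros t Ht; unfold shiftn; rewrite Nat.add_comm; symmetry; apply H, Ht.
Qed.

(** Balls and cylinders refine each other, and monotonicity carries positivity across; later
    arguments speak only of words. *)
Lemma omega_xi_occ (xi : (nat -> Prop) -> Rbar) (k : nat) (x y : nat -> nat) :
  monotone_density xi -> InSigma k x ->
  (omega_xi xi k x y <-> InSigma k y /\ forall r, Rbar_lt 0%R (xi (occ y r x))).
Proof.
  intros Hxi Hx; split; intros [Hy H]; (split; [exact Hy |]).
  - intros r; apply Hxi with (2 := H _ (half_pow_pos r)).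
    intros i; apply occ_of_Nset.
  - intros eps He; destruct (half_pow_small eps He) as [r Hr].
    apply Hxi with (2 := H r); intros i; apply Nset_of_occ; assumption.
Qed.

Lemma omega_upper_Banach_sub (k : nat) (x : nat -> nat) :
  set_sub (omega_xi upper_Banach k x) (omega_sigma k x).
Proof.
  intros y [Hy H]; split; [exact Hy | intros eps He N].
  destruct (half_pow_small eps He) as [r Hr].
  destruct (upper_Banach_pos_infinite _ N (H _ (half_pow_pos r))) as [n [Hn Hn']].
  exists n; split; [exact Hn |].
  apply occ_of_Nset in Hn'; destruct Hn' as [_ Hn'].
  eapply Rle_lt_trans; [apply (dist_agree r) | exact Hr].
  intros t Ht; unfold shiftn; rewrite Nat.add_comm; apply Hn', Ht.
Qed.

Lemma set_ssub_intro (A B : (nat -> nat) -> Prop) (y : nat -> nat) :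
  set_sub A B -> B y -> ~ A y -> set_ssub A B.
Proof. intros HAB HB HA; split; [exact HAB | intros E; apply HA, E, HB]. Qed.

(* The digit [a m] governs infinitely many odd stages; the even stages do not
   depend on [a] and take each of the values 0 and 1 infinitely often. *)
Definition stage_bit (a : nat -> bool) (n : nat) : nat :=
  if Nat.even n then (n / 2) mod 2
  else if a (fst (of_nat (n / 2))) then 1 else 0.

(** * The three patterns of base symbols *)

Inductive pattern := Mixed | Pure | MixedOrZero.

Definition base (p : pattern) (a : nat -> bool) (n j : nat) : nat :=
  match p with
  | Mixed => (j + stage_bit a n) mod 2
  | Pure => stage_bit a n
  | MixedOrZero => if Nat.even n then 0 else (j + stage_bit a n) mod 2
  end.

Lemma stage_bit_even (a : nat -> bool) (s : nat) : stage_bit a (2 * s) = s mod 2.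
Proof.
  unfold stage_bit; rewrite Nat.even_even, Nat.mul_comm, Nat.div_mul by lia; reflexivity.
Qed.

Lemma stage_bit_odd (a : nat -> bool) (s : nat) :
  stage_bit a (2 * s + 1) = if a (fst (of_nat s)) then 1 else 0.
Proof.
  unfold stage_bit; rewrite Nat.even_odd.
  now replace ((2 * s + 1) / 2) with s
    by (rewrite Nat.mul_comm, Nat.div_add_l by lia; simpl; lia).
Qed.

Lemma mod2_cases (n : nat) : n mod 2 = 0 \/ n mod 2 = 1.
Proof. assert (H := Nat.mod_upper_bound n 2 ltac:(lia)); lia. Qed.

Lemma mod2_succ (n : nat) : (n + 1) mod 2 = 1 - n mod 2.
Proof.
  rewrite <- Nat.Div0.add_mod_idemp_l.
  destruct (mod2_cases n) as [-> | ->]; reflexivity.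
Qed.

Lemma mod2_add2 (n : nat) : (n + 2) mod 2 = n mod 2.
Proof. exact (Nat.Div0.mod_add n 1 2). Qed.

Lemma stage_bit_le (a : nat -> bool) (n : nat) : stage_bit a n <= 1.
Proof.
  unfold stage_bit; destruct (Nat.even n).
  - destruct (mod2_cases (n / 2)); lia.
  - destruct (a _); lia.
Qed.

Lemma base_le (p : pattern) (a : nat -> bool) (n j : nat) : base p a n j <= 1.
Proof.
  assert (H := stage_bit_le a n); assert (H' := mod2_cases (j + stage_bit a n)).
  destruct p; unfold base; [lia | lia | destruct (Nat.even n); lia].
Qed.

Lemma consecutive_mod2 (c e t : nat) :
  c <= 1 -> (2 * t + 1 + e) mod 2 = c \/ (2 * t + 2 + e) mod 2 = c.
Proof.
  intros Hc; replace (2 * t + 2 + e) with (2 * t + 1 + e + 1) by lia.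
  rewrite mod2_succ; destruct (mod2_cases (2 * t + 1 + e)); lia.
Qed.

Lemma rich_Mixed (a : nat -> bool) (c n : nat) : c <= 1 -> rich (base Mixed a) c n.
Proof. intros Hc t _; apply consecutive_mod2, Hc. Qed.

Lemma rich_MixedOrZero_zero (a : nat -> bool) (n : nat) :
  rich (base MixedOrZero a) 0 n.
Proof.
  intros t _; unfold base; destruct (Nat.even n); [now left |].
  apply consecutive_mod2; lia.
Qed.

(** [2 * (2 * N + c)] is an even stage whose half has parity [c], so every parameter gives it the
    symbol [c]. *)
Lemma base_Pure_even (a : nat -> bool) (c N j : nat) :
  c <= 1 -> base Pure a (2 * (2 * N + c)) j = c.
Proof.
  intros Hc; unfold base; rewrite stage_bit_even.
  rewrite (Nat.add_comm (2 * N)), (Nat.mul_comm 2 N), Nat.Div0.mod_add.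
  apply Nat.mod_small; lia.
Qed.

Lemma rich_infinitely_often (p : pattern) (a : nat -> bool) (c N : nat) :
  c <= 1 -> exists n, N <= n /\ rich (base p a) c n.
Proof.
  intros Hc; destruct p.
  - exists N; split; [lia | apply rich_Mixed, Hc].
  - exists (2 * (2 * N + c)); split; [lia | intros t _; left].
    apply base_Pure_even, Hc.
  - exists (2 * N + 1); split; [lia | intros t _].
    unfold base; rewrite Nat.even_odd; apply consecutive_mod2, Hc.
Qed.

Lemma poor_Pure (a : nat -> bool) (c N : nat) :
  exists n, N <= n /\ forall j, 1 <= j <= 2 * n + 4 -> base Pure a n j <> c.
Proof.
  (* With truncated subtraction [1 - c] differs from every [c], also from [c >= 2]. *)
  exists (2 * (2 * N + (1 - c))); split; [lia |].
  intros j _; rewrite base_Pure_even; lia.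
Qed.

Lemma poor_MixedOrZero_one (a : nat -> bool) (N : nat) :
  exists n, N <= n /\ forall j, 1 <= j <= 2 * n + 4 -> base MixedOrZero a n j <> 1.
Proof.
  exists (2 * N); split; [lia |]; intros j _; unfold base; rewrite Nat.even_even; lia.
Qed.

Lemma gap_infinitely_often (p : pattern) (a : nat -> bool) (c N : nat) :
  c <= 1 -> exists n j, N <= n /\ 1 <= j <= 2 * n + 4 /\ base p a n j <> c.
Proof.
  intros Hc.
  (* A block of the opposite symbol is a gap for [c]. *)
  destruct (rich_infinitely_often p a (1 - c) N ltac:(lia)) as [n [Hn Hr]].
  destruct (Hr 0 ltac:(lia)) as [E | E]; [exists n, 1 | exists n, 2];
    (split; [exact Hn | split; [lia |]]); cbn [Nat.mul Nat.add] in E; lia.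
Qed.

Lemma base_agree (p : pattern) (a a' : nat -> bool) (N j : nat) :
  base p a (2 * N) j = base p a' (2 * N) j.
Proof. destruct p; unfold base; rewrite !stage_bit_even; reflexivity. Qed.

Lemma base_differ (p : pattern) (a a' : nat -> bool) (m N : nat) :
  a m <> a' m ->
  exists n, N <= n /\ forall j, base p a n j <> base p a' n j.
Proof.
  (* Cantor pairing: this odd stage is governed by digit [m] and is at least [N]. *)
  intros H; exists (2 * to_nat (m, N) + 1); split.
  - assert (G := to_nat_non_decreasing m N); lia.
  - intros j.
    (* The conclusion [e = e + 1] stands for a contradiction: flipping the digit flips the
       parity. *)
    assert (E : forall e, (j + (if a m then 1 else 0)) mod 2 =
                          (j + (if a' m then 1 else 0)) mod 2 -> e = e + 1).
    { intros e; destruct (a m), (a' m); try easy; rewrite mod2_succ, Nat.add_0_r;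
        destruct (mod2_cases j); lia. }
    destruct p; unfold base; rewrite ?Nat.even_odd, !stage_bit_odd, cancel_of_to;
      simpl fst.
    + intros C; specialize (E 0 C); lia.
    + destruct (a m), (a' m); easy.
    + intros C; specialize (E 0 C); lia.
Qed.

(* Position [r] starts the triple [0 0 1], so that [x r <> x (r + 2)]; this never
   happens inside a constant or alternating block. *)
Definition seed (z : nat -> nat) (r i : nat) : nat :=
  if i <? r then z i else if i =? r + 2 then 1 else 0.

Definition sample (p : pattern) (fl : bool) (z : nat -> nat) (r : nat)
  (a : nat -> bool) : nat -> nat :=
  point (r + 3) (seed z r) (base p a) fl.

Lemma len0_pos (r : nat) : 1 <= r + 3.
Proof. lia. Qed.

(** * Closeness to the given point and DC1 pairs *)

Section Pairs.
Context (p : pattern) (fl : bool) (z : nat -> nat) (r : nat).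

Lemma sample_close (a : nat -> bool) : (dist z (sample p fl z r a) <= (/ 2) ^ r)%R.
Proof.
  apply dist_agree; intros t Ht; unfold sample; rewrite point_prefix by lia.
  unfold seed; destruct (Nat.ltb_spec t r); [reflexivity | lia].
Qed.

(** [S] is any set of times of agreement, so that the bound serves both DC1 and injectivity. *)
Lemma sample_distal_stage (a a' : nat -> bool) (m N : nat) (S : nat -> Prop) :
  a m <> a' m ->
  (forall i, S i -> sample p fl z r a i = sample p fl z r a' i) ->
  forall K, exists n, N <= n /\ 1 <= n /\ K * cnt S 0 n <= n.
Proof.
  intros Ha HS K.
  destruct (base_differ p a a' m (N + K) Ha) as [n [Hn Hb]].
  assert (HL := len_gt (r + 3) (len0_pos r) n).
  assert (C := cnt_differ_stage (r + 3) (seed z r) (base p a) (base p a') fl n S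
    (len0_pos r) (fun j _ => Hb j) HS).
  exists (len (r + 3) n + (2 * n + 4) * len (r + 3) n); nia.
Qed.

Lemma sample_proximal_stage (a a' : nat -> bool) (s : nat) (S : nat -> Prop) :
  (forall i, (forall t, t < s ->
     sample p fl z r a (i + t) = sample p fl z r a' (i + t)) -> S i) ->
  forall K N, exists n, N <= n /\ 1 <= n /\ K * n <= K * cnt S 0 n + n.
Proof.
  (* Even stages are common to all parameters; this one is so late that the initial word and [s]
     border positions weigh less than [1 / K]. *)
  intros HS K N; set (n := 2 * (N + K + s)).
  assert (HL := len_gt (r + 3) (len0_pos r) n).
  assert (C := cnt_agree_stage (r + 3) (seed z r) (base p a) (base p a') fl n s S
    (len0_pos r) (fun j _ => base_agree p a a' (N + K + s) j) HS).
  exists (len (r + 3) n + (2 * n + 4) * len (r + 3) n); nia.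
Qed.

Lemma sample_DC1 (a a' : nat -> bool) (m : nat) :
  a m <> a' m -> DC1_pair (sample p fl z r a) (sample p fl z r a').
Proof.
  intros Ha; split.
  (* Distance below 1/2 forces equal first symbols. *)
  - exists (/ 2)%R; split; [lra |].
    apply LimInf_Phi_zero; intros K N.
    apply (sample_distal_stage a a' m N); [exact Ha |].
    intros i Hi.
    assert (E : (dist (shiftn i (sample p fl z r a)) (shiftn i (sample p fl z r a'))
      < (/ 2) ^ 1)%R) by lra.
    exact (dist_small_agree 1 _ _ E 0 (le_n _)).
  - intros t Ht; destruct (half_pow_small t Ht) as [s Hs].
    apply LimSup_Phi_one, (sample_proximal_stage a a' s).
    intros i Hi; eapply Rle_lt_trans; [apply (dist_agree s) | exact Hs].
    intros u Hu; unfold shiftn; rewrite Nat.add_comm; apply Hi, Hu.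
Qed.

Lemma sample_inj (a a' : nat -> bool) (m : nat) :
  a m <> a' m -> sample p fl z r a <> sample p fl z r a'.
Proof.
  intros Ha E.
  (* For equal points every time is one of agreement, and the bound would read [2 * n <= n] with
     [1 <= n]. *)
  destruct (sample_distal_stage a a' m 0 (fun _ => True) Ha) with (K := 2)
    as [n [_ [Hn Hc]]].
  - intros i _; now rewrite E.
  - rewrite cnt_full in Hc by easy; lia.
Qed.

End Pairs.

(** * Recurrence and the omega sets of one sample *)

Section Sample.
Context (k : nat) (k_ge : 2 <= k) (z : nat -> nat) (z_Sigma : InSigma k z).
Context (p : pattern) (fl : bool) (r : nat).

Lemma sample_Sigma (a : nat -> bool) : InSigma k (sample p fl z r a).
Proof.
  apply point_lt; [apply len0_pos | exact k_ge | | apply base_le].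
  intros i _; unfold seed; destruct (i <? r); [apply z_Sigma |].
  destruct (i =? r + 2); lia.
Qed.

Section OnePoint.
Context (a : nat -> bool).
Local Notation x := (sample p fl z r a).

Lemma sample_Rec : Rec k x.
Proof.
  intros eps He; destruct (half_pow_small eps He) as [s Hs].
  destruct (point_recurrent (r + 3) (seed z r) (base p a) fl (len0_pos r) s 0)
    as [n [_ Hn]].
  exists n; apply Nset_of_occ with s; [apply sample_Sigma | exact Hs | exact Hn].
Qed.

Lemma sample_omega_sigma : omega_sigma k x x.
Proof.
  split; [apply sample_Sigma |]; intros eps He N.
  destruct (half_pow_small eps He) as [s Hs].
  destruct (point_recurrent (r + 3) (seed z r) (base p a) fl (len0_pos r) s N)
    as [n [HN Hn]].
  exists n; split; [exact HN |].
  eapply Rle_lt_trans; [apply (dist_agree s) | exact Hs].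
  intros t Ht; unfold shiftn; rewrite Nat.add_comm; apply (proj2 Hn), Ht.
Qed.

(** Each return shows the seed triple at offset [r]. Symbols at distance two are compared because
    they agree in alternating blocks as well, which covers both values of [fl]. *)
Lemma sample_returns_null : ~ Rbar_lt 0%R (upper_Banach (occ x (r + 3) x)).
Proof.
  set (P := fun u v t : nat => u <> t).
  apply Banach_null_not_pos with
    (Z := fun i => P (x i) (x (i + 1)) (x (i + 2))) (c := r).
  - apply bad_Banach_null; [apply len0_pos | intros n j H; now apply H |].
    intros s H; apply H; destruct fl; [now rewrite mod2_add2 | reflexivity].
  - intros i [_ Hi]; unfold P; rewrite <- Nat.add_assoc, !Hi by lia.
    unfold sample; rewrite !point_prefix by lia; unfold seed.
    destruct (Nat.ltb_spec r r); [lia |].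
    destruct (Nat.eqb_spec r (r + 2)); [lia |].
    destruct (Nat.ltb_spec (r + 2) r); [lia |].
    rewrite Nat.eqb_refl; discriminate.
Qed.

Lemma sample_not_BR : ~ BR k x.
Proof.
  intros H; apply sample_returns_null.
  apply upper_Banach_mono with (2 := H _ (half_pow_pos (r + 3))).
  intros i; apply occ_of_Nset.
Qed.

Lemma sample_not_omega_upper_Banach : ~ omega_xi upper_Banach k x x.
Proof.
  intros H; apply omega_xi_occ in H; [|exact upper_Banach_mono | apply sample_Sigma].
  apply sample_returns_null, (proj2 H).
Qed.

Definition zero_or_one (y : nat -> nat) : Prop :=
  (forall t, y t = 0) \/ (forall t, y t = 1).

(** The local obstruction to being constantly 0 or constantly 1, put into the three-symbol form of
    the counting lemmas. *)
Let P (u v t : nat) : Prop := u <> v \/ 2 <= u.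

Lemma not_zero_or_one (y : nat -> nat) :
  ~ zero_or_one y -> exists t, forall v, P (y t) (y (t + 1)) v.
Proof.
  intros H; destruct (excluded_middle_informative
    (exists t, forall v, P (y t) (y (t + 1)) v)) as [E | E]; [exact E |].
  exfalso; apply H.
  assert (Hy : forall t, y t = y (t + 1) /\ y t < 2).
  { intros t; split.
    - destruct (Nat.eq_dec (y t) (y (t + 1))) as [C | C]; [exact C | exfalso].
      apply E; exists t; intros v; now left.
    - apply Nat.nle_gt; intros C; apply E; exists t; intros v; now right. }
  assert (Hc : forall t, y t = y 0).
  { induction t as [|t IH]; [reflexivity |].
    rewrite <- IH, (proj1 (Hy t)); f_equal; lia. }
  assert (H0 := proj2 (Hy 0)).
  destruct (y 0) as [|[|v]]; [now left | now right | lia].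
Qed.

Lemma base_not_P (n j : nat) : ~ P (base p a n j) (base p a n j) (base p a n j).
Proof. assert (H := base_le p a n j); intros [C | C]; lia. Qed.

Lemma sample_upper_density_only (y : nat -> nat) :
  omega_xi upper_density k x y -> zero_or_one y.
Proof.
  intros H; apply omega_xi_occ in H; [|exact upper_density_mono | apply sample_Sigma].
  destruct H as [_ H].
  destruct (excluded_middle_informative (zero_or_one y)) as [E | E]; [exact E |].
  apply not_zero_or_one in E; destruct E as [t Ht]; exfalso.
  specialize (H (t + 2)); revert H.
  apply upper_null_not_pos with
    (Z := fun i => P (x i) (x (i + 1)) (x (i + 2))) (c := t).
  - apply bad_upper_null; [apply len0_pos | exact base_not_P].
  - intros i [_ Hi]; rewrite <- (Nat.add_assoc i t 1), !Hi by lia; apply Ht.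
Qed.

(** Alternating blocks are long windows full of unequal neighbours, whereas zero special blocks
    contain none; hence [fl = false]. *)
Lemma sample_upper_Banach_only (y : nat -> nat) :
  fl = false -> omega_xi upper_Banach k x y -> zero_or_one y.
Proof.
  intros Hfl H.
  apply omega_xi_occ in H; [|exact upper_Banach_mono | apply sample_Sigma].
  destruct H as [_ H].
  destruct (excluded_middle_informative (zero_or_one y)) as [E | E]; [exact E |].
  apply not_zero_or_one in E; destruct E as [t Ht]; exfalso.
  specialize (H (t + 2)); revert H.
  apply Banach_null_not_pos with
    (Z := fun i => P (x i) (x (i + 1)) (x (i + 2))) (c := t).
  - apply bad_Banach_null; [apply len0_pos | exact base_not_P |].
    rewrite Hfl; intros s [C | C]; lia.
  - intros i [_ Hi]; rewrite <- (Nat.add_assoc i t 1), !Hi by lia; apply Ht.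
Qed.

Lemma constant_Sigma (y : nat -> nat) (c : nat) :
  c <= 1 -> (forall t, y t = c) -> InSigma k y.
Proof. intros Hc Hy t; rewrite Hy; lia. Qed.

Lemma sample_upper_density (y : nat -> nat) :
  zero_or_one y -> omega_xi upper_density k x y.
Proof.
  intros H; apply omega_xi_occ; [exact upper_density_mono | apply sample_Sigma |].
  assert (Hc : y 0 <= 1 /\ forall t, y t = y 0)
    by (destruct H as [H | H]; split; intros; rewrite ?H; lia).
  split; [apply constant_Sigma with (y 0); apply Hc |].
  intros s; apply rich_upper_density; [apply len0_pos | apply Hc |].
  intros N; apply rich_infinitely_often, Hc.
Qed.

Lemma sample_lower_density (y : nat -> nat) (c : nat) :
  c <= 1 -> (forall t, y t = c) -> (forall n, rich (base p a) c n) ->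
  omega_xi lower_density k x y.
Proof.
  intros Hc Hy Hr; apply omega_xi_occ; [exact lower_density_mono | apply sample_Sigma |].
  split; [apply constant_Sigma with c; assumption |].
  intros s; apply rich_lower_density; [apply len0_pos | |].
  - intros t; now rewrite !Hy.
  - rewrite Hy; exact Hr.
Qed.

Lemma sample_not_lower_density (y : nat -> nat) (c : nat) :
  (forall t, y t = c) ->
  (forall N, exists n, N <= n /\ forall j, 1 <= j <= 2 * n + 4 -> base p a n j <> c) ->
  ~ omega_xi lower_density k x y.
Proof.
  intros Hy Hp H.
  apply omega_xi_occ in H; [|exact lower_density_mono | apply sample_Sigma].
  destruct H as [_ H]; specialize (H 1); revert H.
  apply (poor_lower_density (r + 3) (seed z r) _ fl (len0_pos r) _ _ Hp).
  intros i [_ Hi]; now rewrite <- (Hy 0), <- (Hi 0), Nat.add_0_r by lia.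
Qed.

Lemma omega_lower_Banach_sub :
  set_sub (omega_xi lower_Banach k x) (omega_xi lower_density k x).
Proof.
  intros y [Hy H]; split; [exact Hy |]; intros eps He.
  apply lower_Banach_le_lower_density, H, He.
Qed.

Lemma omega_lower_density_sub :
  set_sub (omega_xi lower_density k x) (omega_xi upper_density k x).
Proof.
  intros y [Hy H]; split; [exact Hy |]; intros eps He.
  apply lower_density_le_upper_density, H, He.
Qed.

Lemma omega_upper_density_sub :
  set_sub (omega_xi upper_density k x) (omega_xi upper_Banach k x).
Proof.
  intros y [Hy H]; split; [exact Hy |]; intros eps He.
  apply upper_density_le_upper_Banach, H, He.
Qed.

(** The inclusions leave only constant [y], and each symbol is missing from arbitrarily long blocks
    of the other. *)
Lemma sample_lower_Banach_empty (y : nat -> nat) : ~ omega_xi lower_Banach k x y.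
Proof.
  intros H.
  assert (Hy := sample_upper_density_only y
    (omega_lower_density_sub y (omega_lower_Banach_sub y H))).
  assert (Hc : y 0 <= 1 /\ forall t, y t = y 0)
    by (destruct Hy as [Hy | Hy]; split; intros; rewrite ?Hy; lia).
  apply omega_xi_occ in H; [|exact lower_Banach_mono | apply sample_Sigma].
  destruct H as [_ H]; specialize (H 1); revert H.
  apply (gap_lower_Banach (r + 3) (seed z r) (base p a) fl (len0_pos r) _ (y 0)).
  - intros N; apply gap_infinitely_often, Hc.
  - intros i [_ Hi]; now rewrite <- (Hi 0), Nat.add_0_r by lia.
Qed.

Lemma sample_alternating :
  fl = true -> omega_xi upper_Banach k x (fun t => t mod 2).
Proof.
  intros Hfl; apply omega_xi_occ; [exact upper_Banach_mono | apply sample_Sigma |].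
  split.
  - intros t; destruct (mod2_cases t); lia.
  - intros s; apply alternating_upper_Banach; [apply len0_pos | exact Hfl].
Qed.

Lemma alternating_not_constant : ~ zero_or_one (fun t => t mod 2).
Proof. intros [H | H]; [specialize (H 1) | specialize (H 0)]; discriminate. Qed.

Lemma lower_density_Mixed :
  p = Mixed -> set_eq (omega_xi lower_density k x) (omega_xi upper_density k x).
Proof.
  intros Hp y; split; [apply omega_lower_density_sub |].
  intros H; apply sample_upper_density_only in H.
  destruct H as [H | H].
  - apply sample_lower_density with 0; [lia | exact H |].
    intros n; rewrite Hp; apply rich_Mixed; lia.
  - apply sample_lower_density with 1; [lia | exact H |].
    intros n; rewrite Hp; apply rich_Mixed; lia.
Qed.

Lemma lower_density_Pure (y : nat -> nat) :
  p = Pure -> ~ omega_xi lower_density k x y.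
Proof.
  intros Hp H.
  assert (Hy := sample_upper_density_only y (omega_lower_density_sub y H)).
  destruct Hy as [Hy | Hy]; revert H; eapply sample_not_lower_density; try exact Hy;
    intros N; rewrite Hp; apply poor_Pure.
Qed.

Lemma lower_density_zero :
  p <> Pure -> omega_xi lower_density k x (fun _ => 0).
Proof.
  intros Hp; apply sample_lower_density with 0; [lia | reflexivity |].
  intros n; destruct p; [apply rich_Mixed; lia | easy | apply rich_MixedOrZero_zero].
Qed.

Lemma lower_density_one :
  p <> Mixed -> ~ omega_xi lower_density k x (fun _ => 1).
Proof.
  intros Hp; apply sample_not_lower_density with 1; [reflexivity |].
  intros N; destruct p; [easy | apply poor_Pure | apply poor_MixedOrZero_one].
Qed.

Lemma omega_chain_bottom :
  p <> Pure -> set_ssub (omega_xi lower_Banach k x) (omega_xi lower_density k x).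
Proof.
  intros Hp; eapply set_ssub_intro; [apply omega_lower_Banach_sub | |].
  - apply lower_density_zero, Hp.
  - apply sample_lower_Banach_empty.
Qed.

Lemma omega_chain_bottom_eq :
  p = Pure -> set_eq (omega_xi lower_Banach k x) (omega_xi lower_density k x).
Proof.
  intros Hp y; split; intros H; exfalso.
  - exact (sample_lower_Banach_empty y H).
  - exact (lower_density_Pure y Hp H).
Qed.

Lemma omega_chain_middle :
  p <> Mixed -> set_ssub (omega_xi lower_density k x) (omega_xi upper_density k x).
Proof.
  intros Hp; apply set_ssub_intro with (fun _ => 1).
  - apply omega_lower_density_sub.
  - apply sample_upper_density; now right.
  - apply lower_density_one, Hp.
Qed.

Lemma omega_chain_upper :
  fl = true -> set_ssub (omega_xi upper_density k x) (omega_xi upper_Banach k x).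
Proof.
  intros Hfl; eapply set_ssub_intro; [apply omega_upper_density_sub | |].
  - apply sample_alternating, Hfl.
  - intros H; apply sample_upper_density_only in H; now apply alternating_not_constant.
Qed.

Lemma omega_chain_upper_eq :
  fl = false -> set_eq (omega_xi upper_density k x) (omega_xi upper_Banach k x).
Proof.
  intros Hfl y; split; [apply omega_upper_density_sub | intros H].
  apply sample_upper_density, sample_upper_Banach_only, H; exact Hfl.
Qed.

(** The separating point is [x] itself: it recurs, but its returns to a small ball have Banach
    density zero. *)
Lemma omega_chain_top :
  set_ssub (omega_xi upper_Banach k x) (omega_sigma k x).
Proof.
  eapply set_ssub_intro; [apply omega_upper_Banach_sub | |].
  - apply sample_omega_sigma.
  - apply sample_not_omega_upper_Banach.
Qed.

End OnePoint.

End Sample.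

(** * Uncountability and assembly of the theorem *)

Lemma Uncountable_of_injection (g : (nat -> bool) -> nat -> nat)
  (Sset : (nat -> nat) -> Prop) :
  (forall a, Sset (g a)) ->
  (forall a a' m, a m <> a' m -> g a <> g a') ->
  Uncountable Sset.
Proof.
  intros Hg Hinj [f Hf].
  (* Cantor's diagonal: [a] is false at [m] exactly when some parameter with code [m] is true there.
     Evaluating [a] at its own code is contradictory. *)
  set (a := fun m => if excluded_middle_informative
    (exists c, f (g c) = m /\ c m = true) then false else true).
  assert (E : a (f (g a)) = if excluded_middle_informative
    (exists c, f (g c) = f (g a) /\ c (f (g a)) = true) then false else true)
    by reflexivity.
  destruct (excluded_middle_informative _) as [[c [Hc Hc']] | H] in E.
  - apply Hf in Hc; [|apply Hg | apply Hg].
    apply (Hinj c a (f (g a))); [rewrite Hc', E; discriminate | exact Hc].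
  - apply H; exists a; split; [reflexivity | exact E].
Qed.

(** The pattern decides the relations up to upper density, and the flag decides whether upper Banach
    density adds a point; three patterns times two flags give the six cases. *)
Definition case_pattern (i : nat) : pattern :=
  match i with 1 | 2 => Mixed | 3 | 5 => Pure | _ => MixedOrZero end.

Definition case_flag (i : nat) : bool :=
  match i with 2 | 5 | 6 => true | _ => false end.

Lemma sample_Case (k i : nat) (z : nat -> nat) (r : nat) (a : nat -> bool) :
  2 <= k -> InSigma k z -> 1 <= i <= 6 ->
  Case k i (sample (case_pattern i) (case_flag i) z r a).
Proof.
  intros Hk Hz Hi.
  destruct i as [|[|[|[|[|[|[|i]]]]]]]; try lia; unfold Case;
    repeat match goal with |- _ /\ _ => split end;
    first [ now apply omega_chain_bottom | now apply omega_chain_bottom_eq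
          | now apply omega_chain_middle | now apply lower_density_Mixed
          | now apply omega_chain_upper | now apply omega_chain_upper_eq
          | now apply omega_chain_top ].
Qed.

Theorem theoremB (k : nat) (hk : (2 <= k)%nat) (i : nat) (hi : (1 <= i <= 6)%nat) :
  let A := fun x => InSigma k x /\ Rec k x /\ ~ BR k x /\ Case k i x in
  Dense k A /\
  exists S : (nat -> nat) -> Prop,
    (forall x, S x -> A x) /\ Uncountable S /\ DC1_scrambled S.
Proof.
  intros A.
  set (g := fun z r => sample (case_pattern i) (case_flag i) z r).
  assert (HA : forall z r a, InSigma k z -> A (g z r a)).
  { intros z r a Hz; unfold A, g; repeat split.
    - now apply sample_Sigma.
    - now apply sample_Rec.
    - now apply sample_not_BR.
    - now apply sample_Case. }
  split.
  - intros z Hz eps He; destruct (half_pow_small eps He) as [r Hr].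
    exists (g z r (fun _ => true)); split; [apply HA, Hz |].
    eapply Rle_lt_trans; [apply sample_close | exact Hr].
  - assert (H0 : InSigma k (fun _ => 0)) by (intros t; lia).
    set (h := g (fun _ => 0) 0).
    exists (fun x => exists a, x = h a); split; [|split; [|split]].
    + intros x [a ->]; apply HA, H0.
    + apply (Uncountable_of_injection h); [intros a; now exists a |].
      intros a a' m; apply sample_inj.
    + exists (h (fun _ => true)), (h (fun _ => false)).
      split; [now eexists | split; [now eexists |]].
      now apply sample_inj with 0.
    + intros x y [a ->] [a' ->] Hne.
      (* Distinct points come from parameters differing in some digit, and one such digit suffices
         for DC1. *)
      destruct (excluded_middle_informative (exists m, a m <> a' m)) as [[m Hm] | E].
      * now apply sample_DC1 with m.
      * exfalso; apply Hne; f_equal; apply functional_extensionality; intros m.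
        destruct (bool_dec (a m) (a' m)) as [C | C]; [exact C |].
        exfalso; apply E; now exists m.
Qed.
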